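(* Let $p\in(0,1)$ and $b>0$ be fixed, and let $q:(0,\infty)\to(0,1)$ be the function such that, for each $a>0$, $q(a)$ is the unique element of $(0,1)$ satisfying $$\int_0^{q(a)} t^{a-1}(1-t)^{b-1}\,dt = p\int_0^1 t^{a-1}(1-t)^{b-1}\,dt .$$ Then $q$ is a real analytic and increasing function on $(0,\infty)$, with limits $$\lim_{a\to 0} q(a)=0\qquad\text{and}\qquad \lim_{a\to\infty} q(a)=1 .$$
   Context: The value $q(a)$ is the $p$-quantile of the beta distribution with parameters $a,b$ (the inverse regularised incomplete beta function), regarded as a function of the first parameter $a$ with $p$ and $b$ fixed. ''Increasing'' is understood in the non-strict sense unless ''strictly'' is said. *)

(* Defs.v *)
From Stdlib Require Import Reals.
From Coquelicot Require Import Coquelicot.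

Set Implicit Arguments.
Local Open Scope R_scope.

Definition beta_kernel (a b t : R) : R :=
  Rpower t (a - 1) * Rpower (1 - t) (b - 1).

(* The kernel may be unbounded at 0 (when a < 1) and at 1 (when b < 1), so both
   integrals are improper; they converge for all a, b > 0. *)
Definition is_beta_quantile (p b a x : R) : Prop :=
  0 < x < 1 /\
  RInt_gen (beta_kernel a b) (at_right 0) (at_point x) =
  p * RInt_gen (beta_kernel a b) (at_right 0) (at_left 1).

(* Meant for open D: the expansion is required on a full neighbourhood of each
   point of D. *)
Definition real_analytic_on (D : R -> Prop) (f : R -> R) : Prop :=
  forall x0 : R, D x0 ->
  exists c : nat -> R, locally x0 (fun x => is_pseries c (x - x0) (f x)).

Definition increasing_on (D : R -> Prop) (f : R -> R) : Prop :=
  forall x y : R, D x -> D y -> x <= y -> f x <= f y.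

(* Main.v *)
Require Import Defs.
From Stdlib Require Import Reals Lra Lia Ranalysis5 Classical_Prop IndefiniteDescription.
From Coquelicot Require Import Coquelicot.

Local Open Scope R_scope.

(** Write K(a,t) for the beta kernel, H(a,x) for its integral over (0,x) and
T(a,x) for its integral over (x,1).  The quantile is the zero of the gap
H(a,x) - p (H + T) = (1-p) H(a,x) - p T(a,x), which is continuous and strictly
increasing in x, negative near 0 and positive near 1; so it exists and is unique.

Monotonicity and limits.  Raising a by d >= 0 multiplies the kernel by t^d, which
is at most x^d on (0,x) and at least x^d on (x,1).  Hence H(a+d,x) <= x^d H(a,x)
and T(a+d,x) >= x^d T(a,x) ([beta_head_shift], [beta_tail_shift]), so the gap at a
zero x for a is nonpositive for a+d, and the zero moves to the right.  The same two
inequalities, used at two points x < y, make H(a,x)/T(a,x) tend to 0 as a grows,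
which gives the limit 1.  As a tends to 0 the tail stays bounded, while the head is
unbounded because the integral of 1/t diverges at 0, which gives the limit 0.

Analyticity.  A function of h is in [wiener_ball r M] when it is a power series on
|h| < r whose coefficients satisfy sum |c_n| r^n <= M.  These balls have the
algebraic properties of a Banach algebra norm and, decisively, they are closed under
mere pointwise limits ([wiener_ball_lim]), the real substitute for the theorem
that locally bounded pointwise limits of holomorphic functions are holomorphic.
Consequently they are stable under series, composition, integrals and improper
integrals, all of which are pointwise limits of finite operations.  As
K(a+h,t) = exp (h ln t) K(a,t), the gap at a fixed point x is analytic in h.

Let x = q(a) and k = K(a,x).  The simplified Newton map sends a function y of h to
y - gap(a+h, x+y)/k.  Since K(a+h,x+z)/k is within 1/2 of 1 when h and z are small
([beta_kernel_ratio_near_1], valid for z running over a ball of functions), this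
map sends the ball of radius s to itself, and for each fixed h it halves the
distance to the true root q(a+h) - x.  Its iterates from 0 thus stay in one ball
and converge pointwise to q(a+h) - x, which therefore lies in that ball
([beta_quantile_wiener_ball]). *)

(** * Power series with weighted summable coefficients *)

Lemma is_pseries_lim (c : nat -> R) (h l : R) :
  is_pseries c h l <-> is_lim_seq (sum_f_R0 (fun n => c n * h ^ n)) l.
Proof.
rewrite is_pseries_R; split; intros H.
- apply is_lim_seq_ext with (2 := H); intros n; apply sum_n_Reals.
- apply (is_lim_seq_ext _ (sum_n (fun n => c n * h ^ n)) l) with (2 := H).
  intros n; symmetry; apply sum_n_Reals.
Qed.

Definition coef_norm_le (r M : R) (c : nat -> R) : Prop :=
  forall N, sum_f_R0 (fun n => Rabs (c n) * r ^ n) N <= M.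

Lemma coef_norm_le_nonneg r M c : coef_norm_le r M c -> 0 <= M.
Proof.
intros H; specialize (H 0%nat); simpl in H; pose proof (Rabs_pos (c 0%nat)); lra.
Qed.

Lemma sum_abs_le r M c h N :
  coef_norm_le r M c -> Rabs h <= r ->
  sum_f_R0 (fun n => Rabs (c n * h ^ n)) N <= M.
Proof.
intros H Hh; apply Rle_trans with (2 := H N), sum_Rle; intros n _.
rewrite Rabs_mult, <- RPow_abs; apply Rmult_le_compat_l; [apply Rabs_pos|].
apply pow_incr; split; [apply Rabs_pos | exact Hh].
Qed.

Lemma coef_norm_le_ex_pseries r M c h :
  coef_norm_le r M c -> Rabs h <= r -> ex_pseries c h.
Proof.
intros H Hh; apply ex_pseries_R, ex_series_Rabs.
apply (ex_finite_lim_seq_incr (sum_n (fun n => Rabs (c n * h ^ n))) M).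
- intros n; rewrite sum_Sn; unfold plus; simpl.
  pose proof (Rabs_pos (c (S n) * (h * h ^ n))); lra.
- intros n; rewrite sum_n_Reals; now apply sum_abs_le with r.
Qed.

Lemma is_pseries_abs_le r M c h l :
  coef_norm_le r M c -> Rabs h <= r -> is_pseries c h l -> Rabs l <= M.
Proof.
intros H Hh Hl; apply is_pseries_lim in Hl.
apply (is_lim_seq_le (fun N => Rabs (sum_f_R0 (fun n => c n * h ^ n) N))
         (fun _ => M) (Rabs l) M).
- intros N; apply Rle_trans with (1 := Rsum_abs _ N), sum_abs_le with r; auto.
- exact (is_lim_seq_abs _ _ Hl).
- apply is_lim_seq_const.
Qed.

Lemma PSeries_abs_le r M c h :
  coef_norm_le r M c -> Rabs h <= r -> Rabs (PSeries c h) <= M.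
Proof.
intros H Hh; apply (is_pseries_abs_le r M c h); auto.
apply PSeries_correct, (coef_norm_le_ex_pseries r M); auto.
Qed.

(** Dropping the constant term and dividing by the variable costs a factor [1 / r];
this turns norm bounds into bounds on tails and on increments at 0. *)
Lemma coef_norm_le_decr_1 r M c :
  0 < r -> coef_norm_le r M c -> coef_norm_le r (M / r) (PS_decr_1 c).
Proof.
intros Hr H N; apply Rmult_le_reg_r with r; [lra|].
replace (M / r * r) with M by (field; lra).
apply Rle_trans with (2 := H (S N)).
rewrite (decomp_sum _ (S N)) by lia; simpl Init.Nat.pred.
rewrite Rmult_comm, scal_sum; pose proof (Rabs_pos (c 0%nat)); simpl.
match goal with |- ?x <= _ * 1 + ?y => replace x with y; [lra|] end.
apply sum_eq; intros i _; unfold PS_decr_1; ring.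
Qed.

Lemma coef_norm_le_decr_n r M c n :
  0 < r -> coef_norm_le r M c -> coef_norm_le r (M / r ^ n) (PS_decr_n c n).
Proof.
intros Hr; revert M c; induction n as [|n IH]; intros M c H N.
- unfold PS_decr_n; simpl pow; rewrite Rdiv_1_r; apply H.
- specialize (IH _ _ (coef_norm_le_decr_1 r M c Hr H) N).
  replace (M / r ^ S n) with (M / r / r ^ n)
    by (simpl; field; split; [apply pow_nonzero|]; lra).
  exact IH.
Qed.

(** The bound on the norms makes the sums equicontinuous at 0: each differs from its
constant term by at most [Rabs h * (M / r)].  So convergence at nonzero points
forces the constant terms to form a Cauchy sequence. *)
Lemma lim_seq_coef0 r M (c : nat -> nat -> R) :
  0 < r -> (forall k, coef_norm_le r M (c k)) ->
  (forall h, 0 < Rabs h < r -> ex_finite_lim_seq (fun k => PSeries (c k) h)) ->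
  ex_finite_lim_seq (fun k => c k 0%nat).
Proof.
intros Hr Hc Hlim; apply ex_lim_seq_cauchy_corr; intros eps.
assert (HM : 0 <= M / r).
{ apply (coef_norm_le_nonneg r _ _ (coef_norm_le_decr_1 r M _ Hr (Hc 0%nat))). }
(* Three errors of size eps / 4 are added; M / r + 1 avoids a zero divisor. *)
set (h := Rmin (r / 2) (eps / (4 * (M / r + 1)))).
assert (Hh : 0 < h < r /\ h * (M / r + 1) <= eps / 4).
{ assert (He : 0 < eps / (4 * (M / r + 1))).
  { apply Rdiv_lt_0_compat; [apply cond_pos | lra]. }
  assert (h <= eps / (4 * (M / r + 1))) by apply Rmin_r.
  assert (h <= r / 2) by apply Rmin_l.
  assert (0 < h) by (apply Rmin_glb_lt; lra).
  repeat split; try lra.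
  replace (eps / 4) with (eps / (4 * (M / r + 1)) * (M / r + 1))
    by (clearbody h; generalize dependent (M / r); intros A HA; intros; field; lra).
  apply Rmult_le_compat_r; lra. }
destruct Hh as [[h0 hr] hM].
assert (Habs : Rabs h = h) by (apply Rabs_pos_eq; lra).
assert (Hnear : forall k, Rabs (PSeries (c k) h - c k 0%nat) <= eps / 4).
{ intros k.
  rewrite PSeries_decr_1 by (apply (coef_norm_le_ex_pseries r M); [auto | lra]).
  replace (_ + _ - _) with (h * PSeries (PS_decr_1 (c k)) h) by ring.
  rewrite Rabs_mult, Habs; apply Rle_trans with (2 := hM).
  apply Rmult_le_compat_l; [lra|].
  apply Rle_trans with (M / r); [|lra].
  apply (PSeries_abs_le r); [now apply coef_norm_le_decr_1 | lra]. }
assert (Hex : ex_finite_lim_seq (fun k => PSeries (c k) h)) by (apply Hlim; lra).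
apply ex_lim_seq_cauchy_corr in Hex.
assert (He4 : 0 < eps / 4) by (pose proof (cond_pos eps); lra).
destruct (Hex (mkposreal _ He4)) as [N HN]; exists N; intros n m Hn Hm.
specialize (HN n m Hn Hm); simpl in HN.
pose proof (Hnear n) as H1; pose proof (Hnear m) as H2.
pose proof (cond_pos eps).
apply Rabs_def2 in HN.
apply Rabs_le_between in H1; apply Rabs_le_between in H2.
apply Rabs_def1; lra.
Qed.

(** Induction on [n]: once the constant terms converge, so do the difference
quotients at 0, whose coefficients are shifted by one.  Only points [h <> 0] are
available for the quotients, which is why 0 is excluded in the hypothesis. *)
Lemma lim_seq_coef r M (c : nat -> nat -> R) n :
  0 < r -> (forall k, coef_norm_le r M (c k)) ->
  (forall h, 0 < Rabs h < r -> ex_finite_lim_seq (fun k => PSeries (c k) h)) ->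
  ex_finite_lim_seq (fun k => c k n).
Proof.
intros Hr; revert M c; induction n as [|n IH]; intros M c Hc Hlim.
- now apply lim_seq_coef0 with r M.
- apply (IH (M / r) (fun k => PS_decr_1 (c k))).
  + intros k; now apply coef_norm_le_decr_1.
  + intros h Hh; destruct (Hlim h Hh) as [l Hl].
    destruct (lim_seq_coef0 r M c Hr Hc Hlim) as [l0 Hl0].
    exists ((l - l0) / h).
    assert (Hh0 : h <> 0) by (intros ->; rewrite Rabs_R0 in Hh; lra).
    apply is_lim_seq_ext with (fun k => / h * (PSeries (c k) h - c k 0%nat)).
    { intros k.
      rewrite PSeries_decr_1 by (apply (coef_norm_le_ex_pseries r M); [auto | lra]).
      field; exact Hh0. }
    replace (Finite ((l - l0) / h)) with (Rbar_mult (/ h) (l - l0))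
      by (simpl; f_equal; field; exact Hh0).
    apply is_lim_seq_scal_l, is_lim_seq_minus'; assumption.
Qed.

Lemma is_lim_seq_sum_f_R0 (u : nat -> nat -> R) (l : nat -> R) N :
  (forall n, is_lim_seq (fun k => u k n) (l n)) ->
  is_lim_seq (fun k => sum_f_R0 (u k) N) (sum_f_R0 l N).
Proof.
intros H; induction N as [|N IH]; simpl; [apply H|].
apply is_lim_seq_plus'; auto.
Qed.

(** * The balls of the Wiener algebra *)

(** The closed ball of radius [M] in the algebra of power series normed by
the sum of [Rabs (c n) * r ^ n], seen as a set of functions on [Rabs h < r]. *)
Definition wiener_ball (r M : R) (f : R -> R) : Prop :=
  exists c : nat -> R, coef_norm_le r M c /\
    forall h, Rabs h < r -> is_pseries c h (f h).

(** The coefficients converge one by one ([lim_seq_coef]); the norm bound passes to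
the limit, and it also bounds all tails by a common geometric sequence, so the
limit function is the sum of the limit series. *)
Lemma wiener_ball_lim r (Mk : nat -> R) (M : R) (fk : nat -> R -> R) (f : R -> R) :
  0 < r -> (forall k, wiener_ball r (Mk k) (fk k)) -> is_lim_seq Mk M ->
  (forall h, Rabs h < r -> is_lim_seq (fun k => fk k h) (f h)) ->
  wiener_ball r M f.
Proof.
intros Hr Hb HM Hf.
destruct (functional_choice _ Hb) as [c Hc].
assert (HMb : exists x : R, filterlim Mk eventually (locally x))
  by (exists M; exact HM).
destruct (filterlim_bounded Mk HMb) as [M' HM'].
assert (HcM' : forall k, coef_norm_le r M' (c k)).
{ intros k N; apply Rle_trans with (1 := proj1 (Hc k) N).
  apply Rle_trans with (2 := HM' k), Rle_abs. }
assert (HfP : forall h, Rabs h < r -> is_lim_seq (fun k => PSeries (c k) h) (f h)).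
{ intros h Hh; apply is_lim_seq_ext with (2 := Hf h Hh); intros k.
  symmetry; apply is_pseries_unique, Hc, Hh. }
assert (Hd : forall n, exists l : R, is_lim_seq (fun k => c k n) l).
{ intros n; apply (lim_seq_coef r M'); auto.
  intros h Hh; exists (f h); apply HfP; lra. }
destruct (functional_choice _ Hd) as [d Hd'].
exists d; split.
- intros N.
  apply (is_lim_seq_le
    (fun k => sum_f_R0 (fun n => Rabs (c k n) * r ^ n) N) Mk
    (sum_f_R0 (fun n => Rabs (d n) * r ^ n) N) M); auto.
  + intros k; apply (proj1 (Hc k)).
  + apply (is_lim_seq_sum_f_R0 (fun k n => Rabs (c k n) * r ^ n)); intros n.
    apply (is_lim_seq_scal_r _ _ (Rabs (d n))), (is_lim_seq_abs _ (d n)), Hd'.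
- intros h Hh; apply is_pseries_lim.
  set (q := Rabs h / r).
  assert (Hq : 0 <= q < 1).
  { unfold q; split.
    - apply Rmult_le_pos; [apply Rabs_pos | apply Rlt_le, Rinv_0_lt_compat, Hr].
    - apply Rmult_lt_reg_r with r; [lra|]; unfold Rdiv.
      rewrite Rmult_assoc, Rinv_l; lra. }
  assert (Htail : forall N,
    Rabs (sum_f_R0 (fun n => d n * h ^ n) N - f h) <= M' * q ^ S N).
  { intros N.
    apply (is_lim_seq_le
      (fun k => Rabs (sum_f_R0 (fun n => c k n * h ^ n) N - PSeries (c k) h))
      (fun _ => M' * q ^ S N)
      (Rabs (sum_f_R0 (fun n => d n * h ^ n) N - f h)) (M' * q ^ S N)).
    - intros k.
      rewrite (PSeries_decr_n _ N)
        by (apply (coef_norm_le_ex_pseries r M'); [auto | lra]).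
      match goal with |- Rabs (?s - (?s + ?x)) <= _ =>
        replace (s - (s + x)) with (- x) by ring end.
      rewrite Rabs_Ropp, Rabs_mult, <- RPow_abs.
      unfold q, Rdiv; rewrite Rpow_mult_distr, pow_inv.
      replace (M' * (Rabs h ^ S N * / r ^ S N)) with
        (Rabs h ^ S N * (M' / r ^ S N)) by (unfold Rdiv; ring).
      apply Rmult_le_compat_l; [apply pow_le, Rabs_pos|].
      apply (PSeries_abs_le r); [now apply coef_norm_le_decr_n | lra].
    - apply (is_lim_seq_abs _ (sum_f_R0 (fun n => d n * h ^ n) N - f h)).
      apply is_lim_seq_minus'; [|apply HfP, Hh].
      apply (is_lim_seq_sum_f_R0 (fun k n => c k n * h ^ n)); intros n.
      apply (is_lim_seq_scal_r _ _ (d n)), Hd'.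
    - apply is_lim_seq_const. }
  assert (Hgeom : is_lim_seq (fun N => M' * q ^ S N) 0).
  { replace 0 with (M' * 0) by ring.
    apply (is_lim_seq_scal_l _ M' 0).
    apply (is_lim_seq_incr_1 (fun N => q ^ N)), is_lim_seq_geom.
    rewrite Rabs_pos_eq; lra. }
  apply is_lim_seq_ext with
    (fun N => (sum_f_R0 (fun n => d n * h ^ n) N - f h) + f h);
    [intros N; ring|].
  replace (Finite (f h)) with (Finite (0 + f h)) by (f_equal; ring).
  apply is_lim_seq_plus'; [|apply is_lim_seq_const].
  apply is_lim_seq_abs_0.
  apply is_lim_seq_le_le with (fun _ => 0) (fun N => M' * q ^ S N); auto.
  + intros N; split; [apply Rabs_pos | apply Htail].
  + apply is_lim_seq_const.
Qed.

Lemma wiener_ball_ext r M f g :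
  (forall h, Rabs h < r -> f h = g h) -> wiener_ball r M f -> wiener_ball r M g.
Proof.
intros Hfg [c [Hc Hf]]; exists c; split; auto.
intros h Hh; rewrite <- Hfg; auto.
Qed.

Lemma wiener_ball_weaken r M M' f :
  M <= M' -> wiener_ball r M f -> wiener_ball r M' f.
Proof.
intros HM [c [Hc Hf]]; exists c; split; auto.
intros N; apply Rle_trans with (1 := Hc N), HM.
Qed.

Lemma wiener_ball_nonneg r M f : wiener_ball r M f -> 0 <= M.
Proof. intros [c [Hc _]]; exact (coef_norm_le_nonneg _ _ _ Hc). Qed.

Lemma wiener_ball_abs_le r M f h :
  wiener_ball r M f -> Rabs h < r -> Rabs (f h) <= M.
Proof.
intros [c [Hc Hf]] Hh.
apply (is_pseries_abs_le r M c h); [exact Hc | lra | auto].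
Qed.

(** Every monomial of positive degree shrinks at least by the factor [r' / r] when the
radius does: the analogue of the Schwarz lemma.  It supplies the smallness of the data of the
Newton iteration. *)
Lemma wiener_ball_shrink r r' M f :
  0 < r -> 0 < r' <= r -> f 0 = 0 ->
  wiener_ball r M f -> wiener_ball r' (M * r' / r) f.
Proof.
intros Hr Hr' H0 [c [Hc Hf]].
assert (Hc0 : c 0%nat = 0).
{ transitivity (f 0); [|exact H0].
  rewrite <- (PSeries_0 c); apply is_pseries_unique, Hf.
  rewrite Rabs_R0; lra. }
exists c; split; [|intros h Hh; apply Hf; lra].
intros N; apply Rmult_le_reg_r with (r / r');
  [apply Rdiv_lt_0_compat; lra|].
replace (M * r' / r * (r / r')) with M by (field; lra).
apply Rle_trans with (2 := Hc N).
rewrite Rmult_comm, scal_sum; apply sum_Rle; intros n _.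
destruct n as [|n]; [rewrite Hc0, Rabs_R0; lra|].
rewrite Rmult_assoc; apply Rmult_le_compat_l; [apply Rabs_pos|].
simpl; replace (r' * r' ^ n * (r / r')) with (r * r' ^ n) by (field; lra).
apply Rmult_le_compat_l; [lra | apply pow_incr; lra].
Qed.

Lemma wiener_ball_const r a : wiener_ball r (Rabs a) (fun _ => a).
Proof.
exists (fun n => match n with O => a | _ => 0 end).
assert (Hsum : forall (u : nat -> R) (N : nat),
  sum_f_R0 (fun n => u n * match n with O => 1 | _ => 0 end) N = u 0%nat).
{ intros u N; induction N as [|N IH]; simpl; [|rewrite IH]; ring. }
split.
- intros N; right; rewrite <- (Hsum (fun _ => Rabs a) N).
  apply sum_eq; intros [|n] _; [simpl | rewrite Rabs_R0]; ring.
- intros h _; apply is_pseries_lim.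
  apply is_lim_seq_ext with (fun _ => a); [|apply is_lim_seq_const].
  intros N; apply eq_trans with (1 := eq_sym (Hsum (fun _ => a) N)).
  apply sum_eq; intros [|n] _; simpl; ring.
Qed.

Lemma wiener_ball_plus r M1 M2 f g :
  wiener_ball r M1 f -> wiener_ball r M2 g -> 0 <= r ->
  wiener_ball r (M1 + M2) (fun h => f h + g h).
Proof.
intros [c [Hc Hf]] [d [Hd Hg]] Hr.
exists (fun n => c n + d n); split.
- intros N; apply Rle_trans with (2 := Rplus_le_compat _ _ _ _ (Hc N) (Hd N)).
  rewrite <- sum_plus; apply sum_Rle; intros n _.
  rewrite <- Rmult_plus_distr_r; apply Rmult_le_compat_r;
    [apply pow_le, Hr | apply Rabs_triang].
- intros h Hh; apply is_pseries_lim.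
  apply is_lim_seq_ext with (fun N =>
    sum_f_R0 (fun n => c n * h ^ n) N + sum_f_R0 (fun n => d n * h ^ n) N).
  { intros N; rewrite <- sum_plus; apply sum_eq; intros; ring. }
  apply is_lim_seq_plus'; apply is_pseries_lim; auto.
Qed.

Lemma wiener_ball_scal r M a f :
  wiener_ball r M f -> wiener_ball r (Rabs a * M) (fun h => a * f h).
Proof.
intros [c [Hc Hf]]; exists (fun n => a * c n); split.
- intros N; apply Rle_trans with (Rabs a * sum_f_R0 (fun n => Rabs (c n) * r ^ n) N).
  + right; rewrite scal_sum; apply sum_eq; intros; rewrite Rabs_mult; ring.
  + apply Rmult_le_compat_l; [apply Rabs_pos | apply Hc].
- intros h Hh; apply is_pseries_lim.
  apply is_lim_seq_ext with (fun N => a * sum_f_R0 (fun n => c n * h ^ n) N).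
  { intros N; rewrite scal_sum; apply sum_eq; intros; ring. }
  apply (is_lim_seq_scal_l _ a (f h)), is_pseries_lim; auto.
Qed.

Lemma wiener_ball_shift r M f :
  0 <= r -> wiener_ball r M f -> wiener_ball r (r * M) (fun h => h * f h).
Proof.
intros Hr HB; pose proof (wiener_ball_nonneg _ _ _ HB) as HM.
destruct HB as [c [Hc Hf]].
exists (PS_incr_1 c); split.
- intros [|N].
  + simpl; unfold zero; simpl; rewrite Rabs_R0.
    pose proof (Rmult_le_pos _ _ Hr HM); lra.
  + rewrite decomp_sum by lia; simpl; unfold zero; simpl; rewrite Rabs_R0.
    apply Rle_trans with (2 := Rmult_le_compat_l _ _ _ Hr (Hc N)).
    rewrite scal_sum; right; rewrite Rmult_0_l, Rplus_0_l.
    apply sum_eq; intros; ring.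
- intros h Hh; exact (is_pseries_incr_1 c h (f h) (Hf h Hh)).
Qed.

Lemma wiener_ball_id r : 0 <= r -> wiener_ball r r (fun h => h).
Proof.
intros Hr; apply wiener_ball_ext with (fun h => h * 1); [intros; ring|].
apply wiener_ball_weaken with (r * Rabs 1); [rewrite Rabs_R1; lra|].
apply wiener_ball_shift, wiener_ball_const; exact Hr.
Qed.

Lemma wiener_ball_sum r (M : nat -> R) (f : nat -> R -> R) N :
  0 <= r -> (forall n, wiener_ball r (M n) (f n)) ->
  wiener_ball r (sum_f_R0 M N) (fun h => sum_f_R0 (fun n => f n h) N).
Proof.
intros Hr H; induction N as [|N IH]; simpl; [apply H|].
apply wiener_ball_plus; auto.
Qed.

(** Partial sums stay in the ball, so closure under pointwise limits replaces an
exchange of two summations. *)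
Lemma wiener_ball_series r (Mn : nat -> R) M (fn : nat -> R -> R) (f : R -> R) :
  0 < r -> (forall n, wiener_ball r (Mn n) (fn n)) ->
  (forall N, sum_f_R0 Mn N <= M) ->
  (forall h, Rabs h < r ->
     is_lim_seq (sum_f_R0 (fun n => fn n h)) (f h)) ->
  wiener_ball r M f.
Proof.
intros Hr Hn HM Hf.
apply wiener_ball_lim with (fun _ => M)
  (fun N h => sum_f_R0 (fun n => fn n h) N); auto.
- intros N; apply wiener_ball_weaken with (1 := HM N).
  apply wiener_ball_sum; auto; lra.
- apply is_lim_seq_const.
Qed.

Lemma wiener_ball_mult r M1 M2 f g :
  0 < r -> wiener_ball r M1 f -> wiener_ball r M2 g ->
  wiener_ball r (M1 * M2) (fun h => f h * g h).
Proof.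
intros Hr [c [Hc Hf]] Hg.
assert (Hpow : forall n, wiener_ball r (r ^ n * M2) (fun h => h ^ n * g h)).
{ induction n as [|n IH].
  - apply wiener_ball_ext with g; [intros; simpl; ring|].
    simpl; rewrite Rmult_1_l; exact Hg.
  - apply wiener_ball_ext with (fun h => h * (h ^ n * g h));
      [intros; simpl; ring|].
    simpl; rewrite Rmult_assoc; apply wiener_ball_shift; [lra | exact IH]. }
apply wiener_ball_series with (fun n => Rabs (c n) * (r ^ n * M2))
  (fun n h => c n * (h ^ n * g h)); auto.
- intros n; apply wiener_ball_scal, Hpow.
- intros N; apply Rle_trans with (2 := Rmult_le_compat_r _ _ _
    (wiener_ball_nonneg _ _ _ Hg) (Hc N)).
  right; rewrite Rmult_comm, scal_sum; apply sum_eq; intros; ring.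
- intros h Hh; apply is_lim_seq_ext with
    (fun N => sum_f_R0 (fun n => c n * h ^ n) N * g h).
  { intros N; rewrite Rmult_comm, scal_sum; apply sum_eq; intros; ring. }
  apply (is_lim_seq_scal_r _ (g h) (f h)), is_pseries_lim, Hf, Hh.
Qed.

Lemma wiener_ball_pow r M f n :
  0 < r -> wiener_ball r M f -> wiener_ball r (M ^ n) (fun h => f h ^ n).
Proof.
intros Hr Hf; induction n as [|n IH]; simpl.
- rewrite <- Rabs_R1 at 1; apply wiener_ball_const.
- now apply wiener_ball_mult.
Qed.

(** Expanding [phi] at 0 gives a series of powers of [f]; the norm of [f] takes the
place of the radius for the coefficients of [phi]. *)
Lemma wiener_ball_comp r M M' f (d : nat -> R) phi :
  0 < r -> wiener_ball r M f -> coef_norm_le M M' d ->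
  (forall z, Rabs z <= M -> is_pseries d z (phi z)) ->
  wiener_ball r M' (fun h => phi (f h)).
Proof.
intros Hr Hf Hd Hphi.
apply wiener_ball_series with (fun n => Rabs (d n) * M ^ n)
  (fun n h => d n * f h ^ n); auto.
- intros n; apply wiener_ball_scal, wiener_ball_pow; auto.
- intros h Hh; apply is_pseries_lim, Hphi, (wiener_ball_abs_le r); auto.
Qed.

(** The constant 1 is subtracted so that the bound is small when [M] is. *)
Lemma wiener_ball_exp r M f :
  0 < r -> wiener_ball r M f ->
  wiener_ball r (exp M - 1) (fun h => exp (f h) - 1).
Proof.
intros Hr Hf; pose proof (wiener_ball_nonneg _ _ _ Hf) as HM.
set (d := fun n => match n with O => 0 | _ => / INR (Factorial.fact n) end).
assert (Hsum : forall z N, sum_f_R0 (fun n => d n * z ^ n) N =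
  sum_f_R0 (fun n => / INR (Factorial.fact n) * z ^ n) N - 1).
{ intros z N; induction N as [|N IH]; [simpl; field|].
  rewrite !tech5, IH; unfold d; ring. }
assert (Hexp : forall z, is_pseries d z (exp z - 1)).
{ intros z; apply is_pseries_lim.
  apply is_lim_seq_ext with (fun N =>
    sum_f_R0 (fun n => / INR (Factorial.fact n) * z ^ n) N - 1);
    [intros; symmetry; apply Hsum|].
  apply is_lim_seq_minus'; [|apply is_lim_seq_const].
  apply is_pseries_lim, is_exp_Reals. }
assert (Hd : forall n, 0 <= d n).
{ intros [|n]; unfold d; [lra|].
  apply Rlt_le, Rinv_0_lt_compat, lt_0_INR, Factorial.lt_O_fact. }
apply wiener_ball_comp with (M := M) (d := d) (phi := fun z => exp z - 1); auto.
intros N.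
assert (Hincr : forall n, sum_f_R0 (fun n => d n * M ^ n) n <=
                          sum_f_R0 (fun n => d n * M ^ n) (S n)).
{ intros n; rewrite tech5.
  pose proof (Rmult_le_pos _ _ (Hd (S n)) (pow_le M (S n) HM)); lra. }
apply Rle_trans with (sum_f_R0 (fun n => d n * M ^ n) N).
- right; apply sum_eq; intros; rewrite Rabs_pos_eq; auto.
- apply (is_lim_seq_incr_compare (sum_f_R0 (fun n => d n * M ^ n))); auto.
  apply is_pseries_lim, Hexp.
Qed.

Lemma wiener_ball_inv r M f :
  0 < r -> M < 1 -> wiener_ball r M f ->
  wiener_ball r (/ (1 - M)) (fun h => / (1 + f h)).
Proof.
intros Hr HM Hf; pose proof (wiener_ball_nonneg _ _ _ Hf) as HM0.
apply wiener_ball_comp with (M := M) (d := fun n => (-1) ^ n)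
  (phi := fun z => / (1 + z)); auto.
- intros N; apply Rle_trans with (sum_f_R0 (fun n => M ^ n) N).
  + right; apply sum_eq; intros n _; rewrite pow_1_abs.
    ring.
  + apply (is_lim_seq_incr_compare (sum_f_R0 (fun n => M ^ n))).
    * apply is_lim_seq_ext with (sum_n (fun n => M ^ n)); [apply sum_n_Reals|].
      apply is_series_geom; rewrite Rabs_pos_eq; lra.
    * intros n; rewrite tech5; pose proof (pow_le M (S n) HM0); lra.
- intros z Hz; apply is_pseries_R.
  apply is_series_ext with (fun n => (- z) ^ n).
  { intros n; rewrite <- Rpow_mult_distr; f_equal; ring. }
  replace (1 + z) with (1 - - z) by ring.
  apply is_series_geom; rewrite Rabs_Ropp; lra.
Qed.

(** * Integrals depending on a parameter *)

Lemma SF_cons_pointed (x y : R) (s : SF_seq) :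
  pointed_subdiv (SF_cons (x, y) s) -> x <= y <= SF_h s /\ pointed_subdiv s.
Proof.
intros H; split; [|exact (ptd_cons _ _ H)].
apply (H 0%nat); unfold SF_size, SF_cons; simpl; lia.
Qed.

Lemma pointed_subdiv_le_last (s : SF_seq) :
  pointed_subdiv s -> SF_h s <= seq.last (SF_h s) (SF_lx s).
Proof.
induction s as [x0 | [x y] s IH] using SF_cons_ind; intros H; [simpl; lra|].
apply SF_cons_pointed in H; destruct H as [Hxy Hs].
simpl; specialize (IH Hs); simpl in IH; lra.
Qed.

Lemma wiener_ball_Riemann_sum r (phi : R -> R -> R) (m : R -> R) (s : SF_seq) :
  0 <= r -> pointed_subdiv s ->
  (forall t, SF_h s <= t <= seq.last (SF_h s) (SF_lx s) ->
     wiener_ball r (m t) (phi t)) ->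
  wiener_ball r (Riemann_sum m s) (fun h => Riemann_sum (fun t => phi t h) s).
Proof.
intros Hr; induction s as [x0 | [x y] s IH] using SF_cons_ind; intros Hs Hm.
- apply wiener_ball_weaken with (Rabs 0);
    [rewrite Rabs_R0; right; reflexivity | apply (wiener_ball_const r 0)].
- apply SF_cons_pointed in Hs; destruct Hs as [Hxy Hs].
  pose proof (pointed_subdiv_le_last s Hs) as Hlast.
  simpl in Hm, Hlast.
  apply wiener_ball_ext with (fun h =>
    (SF_h s - x) * phi y h + Riemann_sum (fun t => phi t h) s).
  { intros h _; rewrite Riemann_sum_cons; reflexivity. }
  rewrite Riemann_sum_cons; apply (wiener_ball_plus r ((SF_h s - x) * m y)); auto.
  + rewrite <- (Rabs_pos_eq (SF_h s - x)) at 1 by lra.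
    apply wiener_ball_scal, Hm; simpl; lra.
  + apply IH; auto; intros t Ht; apply Hm; simpl in Ht |- *; lra.
Qed.

Definition unif_ptd (u v : R) (k : nat) : SF_seq :=
  SF_seq_f2 (fun x _ => x) (unif_part u v k).

Lemma unif_ptd_spec u v k : u <= v ->
  seq_step (SF_lx (unif_ptd u v k)) <= (v - u) / (INR k + 1) /\
  pointed_subdiv (unif_ptd u v k) /\ SF_h (unif_ptd u v k) = u /\
  seq.last (SF_h (unif_ptd u v k)) (SF_lx (unif_ptd u v k)) = v.
Proof. intros H; apply Riemann_fine_unif_part; [intros; lra | exact H]. Qed.

Lemma is_lim_seq_Riemann_sum (f : R -> R) u v : u < v -> ex_RInt f u v ->
  is_lim_seq (fun k => Riemann_sum f (unif_ptd u v k)) (RInt f u v).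
Proof.
intros Huv Hf; apply (RInt_correct (V := R_CompleteNormedModule)) in Hf; intros P HP.
specialize (Hf P HP).
unfold filtermap, Riemann_fine, within, locally_dist in Hf.
destruct Hf as [delta Hd].
destruct (nfloor_ex ((v - u) / delta)) as [N HN].
{ apply Rlt_le, Rdiv_lt_0_compat; [lra | apply cond_pos]. }
exists N; intros k Hk.
destruct (unif_ptd_spec u v k) as [Hstep [Hptd [Hh Hl]]]; [lra|].
assert (HP' := Hd (unif_ptd u v k)); cbv beta in HP'.
assert (Hsign : scal (sign (v - u)) (Riemann_sum f (unif_ptd u v k)) =
  Riemann_sum f (unif_ptd u v k)).
{ rewrite sign_eq_1 by lra; apply (scal_one (V := R_ModuleSpace)). }
rewrite <- Hsign; apply HP'.
- apply Rle_lt_trans with (1 := Hstep).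
  pose proof (cond_pos delta); pose proof (pos_INR k).
  apply le_INR in Hk.
  apply Rmult_lt_reg_r with (INR k + 1); [lra|].
  unfold Rdiv; rewrite Rmult_assoc, Rinv_l, Rmult_1_r by lra.
  apply Rmult_lt_reg_r with (/ delta); [apply Rinv_0_lt_compat; lra|].
  replace (delta * (INR k + 1) * / delta) with (INR k + 1) by (field; lra).
  unfold Rdiv in HN; lra.
- rewrite Rmin_left, Rmax_right by lra; auto.
Qed.

(** An integral over the parameter [t] is a pointwise limit of Riemann sums; taking
the same subdivisions for [m] makes the radii converge to the integral of [m]. *)
Lemma wiener_ball_RInt r (phi : R -> R -> R) (m : R -> R) u v :
  0 < r -> u < v ->
  (forall t, u <= t <= v -> wiener_ball r (m t) (phi t)) ->
  ex_RInt m u v ->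
  (forall h, Rabs h < r -> ex_RInt (fun t => phi t h) u v) ->
  wiener_ball r (RInt m u v) (fun h => RInt (fun t => phi t h) u v).
Proof.
intros Hr Huv Hphi Hm Hex.
apply wiener_ball_lim with (fun k => Riemann_sum m (unif_ptd u v k))
  (fun k h => Riemann_sum (fun t => phi t h) (unif_ptd u v k)); auto.
- intros k; destruct (unif_ptd_spec u v k) as [_ [Hptd [Hh Hl]]]; [lra|].
  apply wiener_ball_Riemann_sum; [lra | exact Hptd|].
  rewrite Hh in Hl |- *; rewrite Hl; exact Hphi.
- apply is_lim_seq_Riemann_sum; auto.
- intros h Hh; apply is_lim_seq_Riemann_sum; auto.
Qed.

Lemma continuous_ex_RInt (f : R -> R) u v :
  (forall t, Rmin u v <= t <= Rmax u v -> continuous f t) -> ex_RInt f u v.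
Proof. apply (ex_RInt_continuous (V := R_CompleteNormedModule)). Qed.

(** This formula reduces the logarithm to the inverse and an integral. *)
Lemma ln_1p_RInt z : Rabs z < 1 ->
  (forall th, 0 <= th <= 1 -> continuous (fun th => z * / (1 + th * z)) th) /\
  RInt (fun th => z * / (1 + th * z)) 0 1 = ln (1 + z).
Proof.
intros Hz; apply Rabs_def2 in Hz.
assert (Hpos : forall th, 0 <= th <= 1 -> 0 < 1 + th * z).
{ intros th Hth; nra. }
assert (Hcont : forall th, 0 <= th <= 1 ->
  continuous (fun th => z * / (1 + th * z)) th).
{ intros th Hth; apply (ex_derive_continuous (V := R_NormedModule)); auto_derive.
  specialize (Hpos th Hth); lra. }
split; [exact Hcont|].
apply is_RInt_unique.
replace (ln (1 + z)) with (minus (ln (1 + 1 * z)) (ln (1 + 0 * z))).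
2: { unfold minus, plus, opp; simpl.
  rewrite Rmult_0_l, Rplus_0_r, ln_1, Rmult_1_l; ring. }
apply (is_RInt_derive (fun th => ln (1 + th * z)));
  rewrite Rmin_left, Rmax_right by lra; auto.
intros th Hth; specialize (Hpos th Hth); auto_derive; [lra | field; lra].
Qed.

Lemma wiener_ball_ln_1p r M f :
  0 < r -> M < 1 -> wiener_ball r M f ->
  wiener_ball r (M / (1 - M)) (fun h => ln (1 + f h)).
Proof.
intros Hr HM Hf; pose proof (wiener_ball_nonneg _ _ _ Hf) as HM0.
assert (Hb : forall h, Rabs h < r -> Rabs (f h) < 1).
{ intros h Hh; pose proof (wiener_ball_abs_le r M f h Hf Hh); lra. }
apply wiener_ball_ext with
  (fun h => RInt (fun th => f h * / (1 + th * f h)) 0 1).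
{ intros h Hh; apply ln_1p_RInt, Hb, Hh. }
replace (M / (1 - M)) with (RInt (fun _ => M / (1 - M)) 0 1)
  by (rewrite RInt_const; unfold scal; simpl; unfold mult; simpl; ring).
apply (wiener_ball_RInt r (fun th h => f h * / (1 + th * f h))); auto; try lra.
- intros th Hth; apply (wiener_ball_mult r M (/ (1 - M))); auto.
  apply wiener_ball_inv; auto.
  apply wiener_ball_weaken with (Rabs th * M); [|apply wiener_ball_scal, Hf].
  rewrite Rabs_pos_eq by lra; nra.
- apply ex_RInt_const.
- intros h Hh; apply continuous_ex_RInt; rewrite Rmin_left, Rmax_right by lra.
  apply ln_1p_RInt, Hb, Hh.
Qed.

(** * Improper integrals of nonnegative functions *)

Lemma RInt_Chasles_R (f : R -> R) u v w :
  ex_RInt f u v -> ex_RInt f v w -> RInt f u v + RInt f v w = RInt f u w.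
Proof. exact (RInt_Chasles (V := R_CompleteNormedModule) f u v w). Qed.

(** [Da] and [Db] are the ranges of the lower and upper endpoints, so that one
notion covers integrals that are improper at either end. *)
Definition segment_integrals (f : R -> R) (Da Db : R -> Prop) (z : R) : Prop :=
  exists u v, Da u /\ Db v /\ z = RInt f u v.

(** For a nonnegative integrand the integral over a segment increases with the
segment, so its limit along the filters is the least upper bound. *)
Lemma is_RInt_gen_lub (f : R -> R) (Fa Fb : (R -> Prop) -> Prop)
    (Da Db : R -> Prop) (l : R) :
  (forall u0, Da u0 -> Fa (fun u => Da u /\ u <= u0)) ->
  (forall v0, Db v0 -> Fb (fun v => Db v /\ v0 <= v)) ->
  (forall u v, Da u -> Db v -> u <= v) ->
  (forall u v t, Da u -> Db v -> u <= t <= v -> 0 <= f t /\ continuous f t) ->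
  (exists z, segment_integrals f Da Db z) ->
  is_lub (segment_integrals f Da Db) l ->
  is_RInt_gen f Fa Fb l.
Proof.
intros HFa HFb Hle Hf Hne [Hub Hleast] P [eps HP].
assert (Hex : forall u v s t, Da u -> Db v -> u <= s <= v -> u <= t <= v ->
  ex_RInt f s t).
{ intros u v s t Hu Hv Hs Ht; apply continuous_ex_RInt; intros x Hx.
  apply (Hf u v); auto; revert Hx; unfold Rmin, Rmax; destruct (Rle_dec s t); lra. }
assert (Hnear : exists u0 v0, Da u0 /\ Db v0 /\ l - eps < RInt f u0 v0).
{ destruct (classic
    (exists u0 v0, Da u0 /\ Db v0 /\ l - eps < RInt f u0 v0)) as [H|H]; auto.
  exfalso; assert (l <= l - eps); [|pose proof (cond_pos eps); lra].
  apply Hleast; intros z [u [v [Hu [Hv ->]]]].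
  apply Rnot_lt_le; intros Hlt; apply H; exists u, v; auto. }
destruct Hnear as [u0 [v0 [Hu0 [Hv0 Hnear]]]].
apply (Filter_prod _ _ _ _ _ (HFa u0 Hu0) (HFb v0 Hv0)).
intros u v [Hu Huu] [Hv Hvv]; simpl.
assert (Huv0 := Hle u0 v0 Hu0 Hv0).
exists (RInt f u v); split.
{ apply (RInt_correct (V := R_CompleteNormedModule)), (Hex u v); auto; lra. }
apply HP; change (Rabs (RInt f u v - l) < eps).
assert (Hl : RInt f u v <= l) by (apply Hub; exists u, v; auto).
assert (Hmono : RInt f u0 v0 <= RInt f u v).
{ rewrite <- (RInt_Chasles_R f u u0 v), <- (RInt_Chasles_R f u0 v0 v);
    try (apply (Hex u v); auto; lra).
  assert (0 <= RInt f u u0) by (apply RInt_ge_0; [lra | apply (Hex u v); auto; lra |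
    intros t Ht; apply (Hf u v); auto; lra]).
  assert (0 <= RInt f v0 v) by (apply RInt_ge_0; [lra | apply (Hex u v); auto; lra |
    intros t Ht; apply (Hf u v); auto; lra]).
  lra. }
apply Rabs_def1; pose proof (cond_pos eps); lra.
Qed.

Lemma RInt_gen_is_lub (f : R -> R) (Fa Fb : (R -> Prop) -> Prop)
    {FFa : ProperFilter Fa} {FFb : ProperFilter Fb} (Da Db : R -> Prop) (M : R) :
  (forall u0, Da u0 -> Fa (fun u => Da u /\ u <= u0)) ->
  (forall v0, Db v0 -> Fb (fun v => Db v /\ v0 <= v)) ->
  (forall u v, Da u -> Db v -> u <= v) ->
  (forall u v t, Da u -> Db v -> u <= t <= v -> 0 <= f t /\ continuous f t) ->
  (exists z, segment_integrals f Da Db z) ->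
  (forall u v, Da u -> Db v -> RInt f u v <= M) ->
  is_RInt_gen f Fa Fb (RInt_gen f Fa Fb) /\
  is_lub (segment_integrals f Da Db) (RInt_gen f Fa Fb).
Proof.
intros HFa HFb Hle Hf Hne HM.
destruct (completeness (segment_integrals f Da Db)) as [l Hl]; auto.
{ exists M; intros z [u [v [Hu [Hv ->]]]]; auto. }
assert (Hgen : is_RInt_gen f Fa Fb l) by (apply is_RInt_gen_lub with Da Db; auto).
assert (Heq : RInt_gen f Fa Fb = l).
{ apply (is_RInt_gen_unique (V := R_CompleteNormedModule)), Hgen. }
rewrite Heq; auto.
Qed.

Lemma is_RInt_gen_lim_seq (f : R -> R) (Fa Fb : (R -> Prop) -> Prop)
    (u v : nat -> R) (l : R) :
  is_RInt_gen f Fa Fb l ->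
  filterlim u eventually Fa -> filterlim v eventually Fb ->
  is_lim_seq (fun n => RInt f (u n) (v n)) l.
Proof.
intros Hf Hu Hv P HP; destruct (Hf P HP) as [Q S HQ HS H].
destruct (Hu Q HQ) as [N1 H1]; destruct (Hv S HS) as [N2 H2].
exists (N1 + N2)%nat; intros n Hn.
destruct (H (u n) (v n)) as [y [Hy HPy]]; [apply H1; lia | apply H2; lia|].
simpl in Hy; rewrite (is_RInt_unique (V := R_CompleteNormedModule) _ _ _ _ Hy); exact HPy.
Qed.

Lemma wiener_ball_RInt_gen r M (phi : R -> R -> R) (m f : R -> R)
    (Fa Fb : (R -> Prop) -> Prop) (u v : nat -> R) :
  0 < r ->
  filterlim u eventually Fa -> filterlim v eventually Fb ->
  (forall n, u n < v n) ->
  (forall n t, u n <= t <= v n -> wiener_ball r (m t) (phi t)) ->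
  (forall n, ex_RInt m (u n) (v n)) ->
  (forall n h, Rabs h < r -> ex_RInt (fun t => phi t h) (u n) (v n)) ->
  (forall n, RInt m (u n) (v n) <= M) ->
  (forall h, Rabs h < r -> is_RInt_gen (fun t => phi t h) Fa Fb (f h)) ->
  wiener_ball r M f.
Proof.
intros Hr Hu Hv Huv Hphi Hm Hex HM Hf.
apply wiener_ball_lim with (fun _ => M)
  (fun n h => RInt (fun t => phi t h) (u n) (v n)); auto.
- intros n; apply wiener_ball_weaken with (1 := HM n).
  apply wiener_ball_RInt; auto; apply Hphi.
- apply is_lim_seq_const.
- intros h Hh; apply is_RInt_gen_lim_seq with Fa Fb; auto.
Qed.

(** * The beta kernel *)

Lemma exp_le_compat x y : x <= y -> exp x <= exp y.
Proof.
intros [H | ->]; [apply Rlt_le, exp_increasing, H | lra].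
Qed.

Lemma Rpower_pos x y : 0 < Rpower x y.
Proof. apply exp_pos. Qed.

Lemma beta_kernel_pos a b t : 0 < beta_kernel a b t.
Proof. apply Rmult_lt_0_compat; apply exp_pos. Qed.

Lemma beta_kernel_continuous a b t : 0 < t < 1 -> continuous (beta_kernel a b) t.
Proof.
intros Ht; apply (ex_derive_continuous (V := R_NormedModule)).
unfold beta_kernel, Rpower; auto_derive; lra.
Qed.

Lemma beta_kernel_ex_RInt a b u v :
  0 < u < 1 -> 0 < v < 1 -> ex_RInt (beta_kernel a b) u v.
Proof.
intros Hu Hv; apply continuous_ex_RInt; intros t Ht; apply beta_kernel_continuous.
revert Ht; unfold Rmin, Rmax; destruct (Rle_dec u v); lra.
Qed.

(** The only dependence of the kernel on its first parameter: everything below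
about varying [a] comes from the factor [Rpower t d]. *)
Lemma beta_kernel_shift a b d t :
  beta_kernel (a + d) b t = Rpower t d * beta_kernel a b t.
Proof.
unfold beta_kernel; replace (a + d - 1) with (d + (a - 1)) by ring.
rewrite Rpower_plus; ring.
Qed.

Lemma is_derive_Rpower_div a t :
  a <> 0 -> 0 < t -> is_derive (fun t => Rpower t a / a) t (Rpower t (a - 1)).
Proof.
intros Ha Ht.
replace (Rpower t (a - 1)) with (Rpower t a * / t).
- unfold Rpower; auto_derive; [lra | field; lra].
- unfold Rminus; rewrite Rpower_plus, Rpower_Ropp, Rpower_1; auto.
Qed.

Lemma Rpower_le_half s c :
  / 2 <= s < 1 -> Rpower s c <= 1 + Rpower (/ 2) c.
Proof.
intros Hs; pose proof (Rpower_pos (/ 2) c).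
assert (H2 : ln (/ 2) <= ln s) by (apply ln_le; lra).
assert (H1 : ln s < 0) by (rewrite <- ln_1; apply ln_increasing; lra).
destruct (Rle_lt_dec 0 c) as [Hc|Hc].
- assert (Rpower s c <= 1); [|lra].
  rewrite <- exp_0; apply exp_le_compat; nra.
- assert (Rpower s c <= Rpower (/ 2) c); [|lra].
  apply exp_le_compat; nra.
Qed.

(** On each half of the interval one factor of the kernel is bounded, so up to a
constant the kernel is dominated by the sum of its two factors, whose
antiderivative is explicit and bounded on (0,1). *)
Lemma beta_kernel_RInt_bounded a b : 0 < a -> 0 < b ->
  exists M, forall u v, 0 < u -> u <= v -> v < 1 -> RInt (beta_kernel a b) u v <= M.
Proof.
intros Ha Hb.
(* C bounds each factor on the half of (0,1) away from its own singularity. *)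
set (C := (1 + Rpower (/ 2) (a - 1)) + (1 + Rpower (/ 2) (b - 1))).
pose proof (Rpower_pos (/ 2) (a - 1)) as Ca; pose proof (Rpower_pos (/ 2) (b - 1)) as Cb.
set (g := fun t => C * (Rpower t (a - 1) + Rpower (1 - t) (b - 1))).
set (G := fun t => C * (Rpower t a / a - Rpower (1 - t) b / b)).
exists (C * (/ a + / b)); intros u v Hu Huv Hv.
assert (Hg : is_RInt g u v (minus (G v) (G u))).
{ apply (is_RInt_derive G g); rewrite Rmin_left, Rmax_right by lra; intros t Ht.
  - unfold G, g.
    apply (is_derive_scal (fun t => Rpower t a / a - Rpower (1 - t) b / b)).
    replace (Rpower t (a - 1) + Rpower (1 - t) (b - 1)) with
      (minus (Rpower t (a - 1)) (scal (-1) (Rpower (1 - t) (b - 1))))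
      by (unfold minus, plus, opp, scal; simpl; unfold mult; simpl; ring).
    apply (is_derive_minus (fun t => Rpower t a / a) (fun t => Rpower (1 - t) b / b)).
    + apply is_derive_Rpower_div; lra.
    + apply (is_derive_comp (fun s => Rpower s b / b) (fun t => 1 - t)).
      * apply is_derive_Rpower_div; lra.
      * auto_derive; [auto | ring].
  - apply (ex_derive_continuous (V := R_NormedModule)).
    unfold g, Rpower; auto_derive; lra. }
apply Rle_trans with (RInt g u v).
- apply RInt_le; [lra | apply beta_kernel_ex_RInt; lra | eexists; exact Hg|].
  intros t Ht; unfold g, beta_kernel.
  pose proof (Rpower_pos t (a - 1)) as P1; pose proof (Rpower_pos (1 - t) (b - 1)) as P2.
  assert (Hsplit : t <= / 2 \/ / 2 <= t) by lra.
  destruct Hsplit as [Hh|Hh].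
  + assert (Rpower (1 - t) (b - 1) <= C)
      by (pose proof (Rpower_le_half (1 - t) (b - 1)); unfold C; lra).
    nra.
  + assert (Rpower t (a - 1) <= C)
      by (pose proof (Rpower_le_half t (a - 1)); unfold C; lra).
    nra.
- rewrite (is_RInt_unique (V := R_CompleteNormedModule) _ _ _ _ Hg).
  unfold minus, plus, opp, G; simpl.
  assert (HR : forall s c, 0 < c -> 0 < s < 1 -> 0 <= Rpower s c / c <= / c).
  { intros s c Hc Hs; split.
    - apply Rlt_le, Rdiv_lt_0_compat; [apply Rpower_pos | exact Hc].
    - unfold Rdiv; rewrite <- (Rmult_1_l (/ c)) at 2.
      apply Rmult_le_compat_r; [apply Rlt_le, Rinv_0_lt_compat, Hc|].
      rewrite <- exp_0; apply exp_le_compat.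
      assert (ln s < 0) by (rewrite <- ln_1; apply ln_increasing; lra).
      nra. }
  pose proof (HR u a Ha); pose proof (HR v a Ha).
  pose proof (HR (1 - u) b Hb); pose proof (HR (1 - v) b Hb).
  assert (HC : 0 < C) by (unfold C; lra).
  match goal with |- C * ?x + - (C * ?y) <= C * ?z =>
    replace (C * x + - (C * y)) with (C * (x - y)) by ring end.
  apply Rmult_le_compat_l; lra.
Qed.

(** * Head and tail of the beta integral *)

Definition beta_head (a b x : R) : R :=
  RInt_gen (beta_kernel a b) (at_right 0) (at_point x).

Definition beta_tail (a b x : R) : R :=
  RInt_gen (beta_kernel a b) (at_point x) (at_left 1).

Lemma at_right_0_below (u0 x : R) : 0 < u0 <= x ->
  at_right 0 (fun u => (0 < u <= x) /\ u <= u0).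
Proof.
intros H; exists (mkposreal u0 (proj1 H)); intros y Hy Hy0.
apply Rabs_def2 in Hy; unfold minus, plus, opp in Hy; simpl in Hy; lra.
Qed.

Lemma at_left_1_above (v0 x : R) : x <= v0 < 1 ->
  at_left 1 (fun v => (x <= v < 1) /\ v0 <= v).
Proof.
intros H; assert (H1 : 0 < 1 - v0) by lra.
exists (mkposreal (1 - v0) H1); intros y Hy Hy0.
apply Rabs_def2 in Hy; unfold minus, plus, opp in Hy; simpl in Hy; lra.
Qed.

Lemma beta_head_spec a b x : 0 < a -> 0 < b -> 0 < x < 1 ->
  is_RInt_gen (beta_kernel a b) (at_right 0) (at_point x) (beta_head a b x) /\
  is_lub (segment_integrals (beta_kernel a b) (fun u => 0 < u <= x) (fun v => v = x))
    (beta_head a b x).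
Proof.
intros Ha Hb Hx; destruct (beta_kernel_RInt_bounded a b Ha Hb) as [M HM].
apply (RInt_gen_is_lub _ _ _ _ _ M).
- intros u0 Hu0; now apply at_right_0_below.
- intros v0 ->; split; [reflexivity | apply Rle_refl].
- intros u v Hu ->; lra.
- intros u v t Hu -> Ht; split;
    [apply Rlt_le, beta_kernel_pos | apply beta_kernel_continuous; lra].
- exists (RInt (beta_kernel a b) x x), x, x; repeat split; lra.
- intros u v Hu ->; apply HM; lra.
Qed.

Lemma beta_tail_spec a b x : 0 < a -> 0 < b -> 0 < x < 1 ->
  is_RInt_gen (beta_kernel a b) (at_point x) (at_left 1) (beta_tail a b x) /\
  is_lub (segment_integrals (beta_kernel a b) (fun u => u = x) (fun v => x <= v < 1))
    (beta_tail a b x).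
Proof.
intros Ha Hb Hx; destruct (beta_kernel_RInt_bounded a b Ha Hb) as [M HM].
apply (RInt_gen_is_lub _ _ _ _ _ M).
- intros u0 ->; split; [reflexivity | apply Rle_refl].
- intros v0 Hv0; now apply at_left_1_above.
- intros u v -> Hv; lra.
- intros u v t -> Hv Ht; split;
    [apply Rlt_le, beta_kernel_pos | apply beta_kernel_continuous; lra].
- exists (RInt (beta_kernel a b) x x), x, x; repeat split; lra.
- intros u v -> Hv; apply HM; lra.
Qed.

Lemma RInt_le_beta_head a b u x : 0 < a -> 0 < b -> 0 < u <= x -> x < 1 ->
  RInt (beta_kernel a b) u x <= beta_head a b x.
Proof.
intros Ha Hb Hu Hx; destruct (beta_head_spec a b x) as [_ [H _]]; try lra.
apply H; exists u, x; auto.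
Qed.

Lemma RInt_le_beta_tail a b x v : 0 < a -> 0 < b -> 0 < x <= v -> v < 1 ->
  RInt (beta_kernel a b) x v <= beta_tail a b x.
Proof.
intros Ha Hb Hv Hx; destruct (beta_tail_spec a b x) as [_ [H _]]; try lra.
apply H; exists x, v; repeat split; lra.
Qed.

Lemma beta_head_le_bound a b x C : 0 < a -> 0 < b -> 0 < x < 1 ->
  (forall u, 0 < u <= x -> RInt (beta_kernel a b) u x <= C) -> beta_head a b x <= C.
Proof.
intros Ha Hb Hx HC; destruct (beta_head_spec a b x) as [_ [_ H]]; try lra.
apply H; intros z [u [v [Hu [-> ->]]]]; auto.
Qed.

Lemma beta_tail_le_bound a b x C : 0 < a -> 0 < b -> 0 < x < 1 ->
  (forall v, x <= v < 1 -> RInt (beta_kernel a b) x v <= C) -> beta_tail a b x <= C.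
Proof.
intros Ha Hb Hx HC; destruct (beta_tail_spec a b x) as [_ [_ H]]; try lra.
apply H; intros z [u [v [-> [Hv ->]]]]; auto.
Qed.

Lemma beta_total a b x : 0 < a -> 0 < b -> 0 < x < 1 ->
  RInt_gen (beta_kernel a b) (at_right 0) (at_left 1) =
  beta_head a b x + beta_tail a b x.
Proof.
intros Ha Hb Hx.
apply (is_RInt_gen_unique (V := R_CompleteNormedModule)).
apply (is_RInt_gen_Chasles (V := R_NormedModule) (beta_kernel a b) x).
- now apply beta_head_spec.
- now apply beta_tail_spec.
Qed.

Lemma beta_head_Chasles a b x y : 0 < a -> 0 < b -> 0 < x < 1 -> 0 < y < 1 ->
  beta_head a b y = beta_head a b x + RInt (beta_kernel a b) x y.
Proof.
intros Ha Hb Hx Hy.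
apply (is_RInt_gen_unique (V := R_CompleteNormedModule)).
apply (is_RInt_gen_Chasles (V := R_NormedModule) (beta_kernel a b) x).
- now apply beta_head_spec.
- apply is_RInt_gen_at_point, (RInt_correct (V := R_CompleteNormedModule)).
  now apply beta_kernel_ex_RInt.
Qed.

Lemma beta_tail_Chasles a b x y : 0 < a -> 0 < b -> 0 < x < 1 -> 0 < y < 1 ->
  beta_tail a b x = RInt (beta_kernel a b) x y + beta_tail a b y.
Proof.
intros Ha Hb Hx Hy.
pose proof (beta_head_Chasles a b x y Ha Hb Hx Hy).
pose proof (beta_total a b x Ha Hb Hx); pose proof (beta_total a b y Ha Hb Hy).
lra.
Qed.

Lemma beta_kernel_RInt_pos a b u v : 0 < u -> u < v -> v < 1 ->
  0 < RInt (beta_kernel a b) u v.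
Proof.
intros Hu Huv Hv; apply RInt_gt_0; [exact Huv | intros; apply beta_kernel_pos|].
intros t Ht; apply beta_kernel_continuous; lra.
Qed.

Lemma beta_head_increasing a b x y : 0 < a -> 0 < b -> 0 < x -> x < y -> y < 1 ->
  beta_head a b x < beta_head a b y.
Proof.
intros Ha Hb Hx Hxy Hy; rewrite (beta_head_Chasles a b x y) by lra.
pose proof (beta_kernel_RInt_pos a b x y Hx Hxy Hy); lra.
Qed.

Lemma beta_head_pos a b x : 0 < a -> 0 < b -> 0 < x < 1 -> 0 < beta_head a b x.
Proof.
intros Ha Hb Hx.
apply Rlt_le_trans with (RInt (beta_kernel a b) (x / 2) x).
- apply beta_kernel_RInt_pos; lra.
- apply RInt_le_beta_head; lra.
Qed.

Lemma beta_tail_pos a b x : 0 < a -> 0 < b -> 0 < x < 1 -> 0 < beta_tail a b x.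
Proof.
intros Ha Hb Hx.
apply Rlt_le_trans with (RInt (beta_kernel a b) x ((x + 1) / 2)).
- apply beta_kernel_RInt_pos; lra.
- apply RInt_le_beta_tail; lra.
Qed.

(** * The quantile *)

(** The bracket is the complete beta integral, cut at the arbitrary point [/ 2] so
that only one-sided improper integrals occur. *)
Definition quantile_gap (p b a x : R) : R :=
  beta_head a b x - p * (beta_head a b (/ 2) + beta_tail a b (/ 2)).

Lemma quantile_gap_eq p b a x : 0 < a -> 0 < b -> 0 < x < 1 ->
  quantile_gap p b a x = (1 - p) * beta_head a b x - p * beta_tail a b x.
Proof.
intros Ha Hb Hx; unfold quantile_gap.
rewrite <- (beta_total a b (/ 2)), (beta_total a b x) by lra; ring.
Qed.

Lemma is_beta_quantile_iff p b a x : 0 < a -> 0 < b ->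
  is_beta_quantile p b a x <-> 0 < x < 1 /\ quantile_gap p b a x = 0.
Proof.
intros Ha Hb; unfold is_beta_quantile, quantile_gap.
rewrite (beta_total a b (/ 2)) by lra; fold (beta_head a b x).
split; intros [H1 H2]; split; auto; lra.
Qed.

Lemma quantile_gap_Chasles p b a x y : 0 < a -> 0 < b -> 0 < x < 1 -> 0 < y < 1 ->
  quantile_gap p b a y = quantile_gap p b a x + RInt (beta_kernel a b) x y.
Proof.
intros Ha Hb Hx Hy; unfold quantile_gap; rewrite (beta_head_Chasles a b x y) by lra.
ring.
Qed.

Lemma quantile_gap_lt_iff p b a x y : 0 < a -> 0 < b -> 0 < x < 1 -> 0 < y < 1 ->
  quantile_gap p b a x < quantile_gap p b a y <-> x < y.
Proof.
intros Ha Hb Hx Hy; unfold quantile_gap; split; intros H.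
- destruct (Rlt_le_dec x y) as [|[Hle | ->]]; auto; [|lra].
  pose proof (beta_head_increasing a b y x Ha Hb (proj1 Hy) Hle (proj2 Hx)); lra.
- pose proof (beta_head_increasing a b x y Ha Hb (proj1 Hx) H (proj2 Hy)); lra.
Qed.

Lemma quantile_gap_neg p b a : 0 < p -> 0 < a -> 0 < b ->
  exists x, 0 < x <= / 2 /\ quantile_gap p b a x < 0.
Proof.
intros Hp Ha Hb.
set (B := beta_head a b (/ 2) + beta_tail a b (/ 2)).
assert (HB : 0 < p * B).
{ apply Rmult_lt_0_compat; [exact Hp|].
  apply Rplus_lt_0_compat; [apply beta_head_pos | apply beta_tail_pos]; lra. }
destruct (classic
  (exists x, 0 < x <= / 2 /\ quantile_gap p b a x < 0)) as [H|H]; auto.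
exfalso; assert (beta_head a b (/ 2) <= beta_head a b (/ 2) - p * B); [|lra].
apply beta_head_le_bound; try lra; intros u Hu.
apply Rnot_lt_le; intros Hlt; apply H; exists u; split; [lra|].
unfold quantile_gap; fold B.
pose proof (beta_head_Chasles a b u (/ 2)); lra.
Qed.

Lemma quantile_gap_positive p b a : p < 1 -> 0 < a -> 0 < b ->
  exists x, / 2 <= x < 1 /\ 0 < quantile_gap p b a x.
Proof.
intros Hp Ha Hb.
set (B := beta_head a b (/ 2) + beta_tail a b (/ 2)).
assert (HB : 0 < (1 - p) * B).
{ apply Rmult_lt_0_compat; [lra|].
  apply Rplus_lt_0_compat; [apply beta_head_pos | apply beta_tail_pos]; lra. }
destruct (classic
  (exists x, / 2 <= x < 1 /\ 0 < quantile_gap p b a x)) as [H|H]; auto.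
exfalso; assert (beta_tail a b (/ 2) <= beta_tail a b (/ 2) - (1 - p) * B); [|lra].
apply beta_tail_le_bound; try lra; intros v Hv.
apply Rnot_lt_le; intros Hlt; apply H; exists v; split; [lra|].
unfold quantile_gap; fold B.
pose proof (beta_head_Chasles a b (/ 2) v); unfold B in *; lra.
Qed.

Lemma beta_kernel_RInt_continuous a b x0 x : 0 < x0 < 1 -> 0 < x < 1 ->
  continuous (RInt (beta_kernel a b) x0) x.
Proof.
intros Hx0 Hx; apply (ex_derive_continuous (V := R_NormedModule)).
exists (beta_kernel a b x).
apply (is_derive_RInt (V := R_NormedModule) _ _ x0);
  [|now apply beta_kernel_continuous].
assert (He : 0 < Rmin x (1 - x)) by (apply Rmin_glb_lt; lra).
exists (mkposreal _ He); intros y Hy.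
apply Rabs_def2 in Hy; unfold minus, plus, opp in Hy; simpl in Hy.
pose proof (Rmin_l x (1 - x)); pose proof (Rmin_r x (1 - x)).
apply (RInt_correct (V := R_CompleteNormedModule)), beta_kernel_ex_RInt; lra.
Qed.

Lemma beta_quantile_exists_unique p b a : 0 < p < 1 -> 0 < b -> 0 < a ->
  exists! x, is_beta_quantile p b a x.
Proof.
intros Hp Hb Ha.
destruct (quantile_gap_neg p b a) as [x1 [Hx1 H1]]; try lra.
destruct (quantile_gap_positive p b a) as [x2 [Hx2 H2]]; try lra.
assert (H12 : x1 < x2) by (apply (quantile_gap_lt_iff p b a); lra).
assert (Hc : forall x, x1 <= x <= x2 -> continuity_pt (quantile_gap p b a) x).
{ intros x Hx; apply continuity_pt_filterlim.
  apply (continuous_ext_loc _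
    (fun y => quantile_gap p b a (/ 2) + RInt (beta_kernel a b) (/ 2) y)).
  - assert (He : 0 < Rmin x (1 - x)) by (apply Rmin_glb_lt; lra).
    exists (mkposreal _ He); intros y Hy.
    apply Rabs_def2 in Hy; unfold minus, plus, opp in Hy; simpl in Hy.
    pose proof (Rmin_l x (1 - x)); pose proof (Rmin_r x (1 - x)).
    symmetry; apply quantile_gap_Chasles; lra.
  - apply (continuous_plus (V := R_NormedModule)); [apply continuous_const|].
    apply beta_kernel_RInt_continuous; lra. }
destruct (IVT_interv (quantile_gap p b a) x1 x2 Hc H12 H1 H2) as [x [Hx Hx0]].
exists x; split.
- apply is_beta_quantile_iff; auto; split; [lra | exact Hx0].
- intros y Hy; apply is_beta_quantile_iff in Hy; auto; destruct Hy as [Hy Hy0].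
  pose proof (quantile_gap_lt_iff p b a x y) as Hxy.
  pose proof (quantile_gap_lt_iff p b a y x) as Hyx.
  destruct (Rtotal_order x y) as [H|[H|H]]; auto.
  + apply Hxy in H; lra.
  + apply Hyx in H; lra.
Qed.

Lemma lt_beta_quantile p b a q x : 0 < a -> 0 < b -> 0 < x < 1 ->
  is_beta_quantile p b a q -> quantile_gap p b a x < 0 -> x < q.
Proof.
intros Ha Hb Hx Hq H; apply is_beta_quantile_iff in Hq; auto.
destruct Hq as [Hq Hq0]; apply (quantile_gap_lt_iff p b a); auto; lra.
Qed.

Lemma beta_quantile_lt p b a q x : 0 < a -> 0 < b -> 0 < x < 1 ->
  is_beta_quantile p b a q -> 0 < quantile_gap p b a x -> q < x.
Proof.
intros Ha Hb Hx Hq H; apply is_beta_quantile_iff in Hq; auto.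
destruct Hq as [Hq Hq0]; apply (quantile_gap_lt_iff p b a); auto; lra.
Qed.

(** * Monotonicity and limits *)

Lemma Rpower_le_base s t d : 0 <= d -> 0 < s <= t -> Rpower s d <= Rpower t d.
Proof.
intros Hd Hst; apply exp_le_compat, Rmult_le_compat_l; [exact Hd|].
apply ln_le; lra.
Qed.

Lemma beta_kernel_RInt_shift a b d u v : 0 <= d -> 0 < u -> u <= v -> v < 1 ->
  Rpower u d * RInt (beta_kernel a b) u v <= RInt (beta_kernel (a + d) b) u v <=
  Rpower v d * RInt (beta_kernel a b) u v.
Proof.
intros Hd Hu Huv Hv.
assert (Hex : forall c, ex_RInt (beta_kernel c b) u v)
  by (intros c; apply beta_kernel_ex_RInt; lra).
assert (Hscal : forall k, RInt (fun t => k * beta_kernel a b t) u v =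
  k * RInt (beta_kernel a b) u v)
  by (intros k; exact (RInt_scal (V := R_CompleteNormedModule) _ _ _ k (Hex a))).
assert (Hexs : forall k, ex_RInt (fun t => k * beta_kernel a b t) u v)
  by (intros k; exact (ex_RInt_scal (V := R_NormedModule) _ _ _ k (Hex a))).
rewrite <- !Hscal; split; apply RInt_le; auto; intros t Ht;
  rewrite beta_kernel_shift; apply Rmult_le_compat_r;
  try (apply Rlt_le, beta_kernel_pos); apply Rpower_le_base; lra.
Qed.

Lemma beta_head_shift a b d x : 0 < a -> 0 < b -> 0 <= d -> 0 < x < 1 ->
  beta_head (a + d) b x <= Rpower x d * beta_head a b x.
Proof.
intros Ha Hb Hd Hx; apply beta_head_le_bound; try lra; intros u Hu.
apply Rle_trans with (Rpower x d * RInt (beta_kernel a b) u x).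
- apply beta_kernel_RInt_shift; lra.
- apply Rmult_le_compat_l; [apply Rlt_le, Rpower_pos|].
  apply RInt_le_beta_head; lra.
Qed.

Lemma beta_tail_shift a b d x : 0 < a -> 0 < b -> 0 <= d -> 0 < x < 1 ->
  Rpower x d * beta_tail a b x <= beta_tail (a + d) b x.
Proof.
intros Ha Hb Hd Hx; pose proof (Rpower_pos x d) as HP.
apply Rmult_le_reg_l with (/ Rpower x d); [apply Rinv_0_lt_compat, HP|].
rewrite <- Rmult_assoc, Rinv_l, Rmult_1_l by lra.
apply beta_tail_le_bound; try lra; intros v Hv.
apply Rmult_le_reg_l with (Rpower x d); [exact HP|].
rewrite <- Rmult_assoc, Rinv_r, Rmult_1_l by lra.
apply Rle_trans with (RInt (beta_kernel (a + d) b) x v).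
- apply beta_kernel_RInt_shift; lra.
- apply RInt_le_beta_tail; lra.
Qed.

(** By the two shift inequalities, the gap for [a + d] at the quantile [x] for [a] is
at most [Rpower x d] times the gap for [a], that is, at most 0. *)
Lemma beta_quantile_increasing p b a d x y : 0 < p < 1 -> 0 < b -> 0 < a -> 0 <= d ->
  is_beta_quantile p b a x -> is_beta_quantile p b (a + d) y -> x <= y.
Proof.
intros Hp Hb Ha Hd Hx Hy.
apply Rnot_lt_le; intros Hlt.
apply is_beta_quantile_iff in Hx; auto; destruct Hx as [Hx Hx0].
apply is_beta_quantile_iff in Hy; try lra; destruct Hy as [Hy Hy0].
apply (quantile_gap_lt_iff p b (a + d)) in Hlt; try lra.
rewrite Hy0, quantile_gap_eq in Hlt by lra; rewrite quantile_gap_eq in Hx0 by lra.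
pose proof (beta_head_shift a b d x Ha Hb Hd Hx).
pose proof (beta_tail_shift a b d x Ha Hb Hd Hx).
pose proof (Rpower_pos x d).
assert ((1 - p) * beta_head (a + d) b x - p * beta_tail (a + d) b x <=
  Rpower x d * ((1 - p) * beta_head a b x - p * beta_tail a b x)) by nra.
rewrite Hx0 in *; lra.
Qed.

(** At [a = 0] the kernel is comparable to [/ t] near 0, and the logarithm is
unbounded.  This is used as a lower bound for the head at small positive [a]. *)
Lemma beta_kernel_RInt_0_unbounded b x C : 0 < x < 1 ->
  exists u, 0 < u <= x /\ C <= RInt (beta_kernel 0 b) u x.
Proof.
intros Hx; set (c := Rmin 1 (Rpower (1 - x) (b - 1))).
assert (Hc0 : 0 < c) by (apply Rmin_glb_lt; [lra | apply Rpower_pos]).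
assert (Hc : forall t, 0 < t <= x -> c <= Rpower (1 - t) (b - 1)).
{ intros t Ht; destruct (Rle_lt_dec 1 b) as [Hb|Hb].
  - apply Rle_trans with (1 := Rmin_r _ _), Rpower_le_base; lra.
  - apply Rle_trans with (1 := Rmin_l _ _); rewrite <- exp_0 at 1.
    apply exp_le_compat.
    assert (ln (1 - t) < 0) by (rewrite <- ln_1; apply ln_increasing; lra); nra. }
set (N := Rmax 0 (C / c)).
assert (HN0 : 0 <= N) by apply Rmax_l.
(* The integral of c / t from x exp(-N) to x is c N, which is at least C. *)
exists (x * exp (- N)).
assert (Hu : 0 < x * exp (- N) <= x).
{ pose proof (exp_pos (- N)) as He; split; [nra|].
  assert (exp (- N) <= exp 0) by (apply exp_le_compat; lra).
  rewrite exp_0 in *; nra. }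
split; [exact Hu|].
set (u := x * exp (- N)) in *.
assert (Hi : is_RInt (fun t => c * / t) u x (c * N)).
{ replace (c * N) with (minus (c * ln x) (c * ln u)).
  2: { unfold minus, plus, opp, u; simpl.
    rewrite ln_mult, ln_exp by (try apply exp_pos; lra); ring. }
  apply (is_RInt_derive (fun t => c * ln t)); rewrite Rmin_left, Rmax_right by lra;
    intros t Ht.
  - auto_derive; [lra | field; lra].
  - apply (ex_derive_continuous (V := R_NormedModule)); auto_derive; lra. }
apply Rle_trans with (c * N).
- replace C with (c * (C / c)) by (field; lra).
  apply Rmult_le_compat_l; [lra | apply Rmax_r].
- rewrite <- (is_RInt_unique (V := R_CompleteNormedModule) _ _ _ _ Hi).
  apply RInt_le; [lra | eexists; exact Hi | apply beta_kernel_ex_RInt; lra|].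
  intros t Ht; unfold beta_kernel.
  replace (Rpower t (0 - 1)) with (/ t).
  + rewrite Rmult_comm; apply Rmult_le_compat_l; [|apply Hc; lra].
    apply Rlt_le, Rinv_0_lt_compat; lra.
  + replace (0 - 1) with (- (1)) by ring.
    rewrite Rpower_Ropp, Rpower_1; [reflexivity | lra].
Qed.

Lemma beta_quantile_lim_0 p b (q : R -> R) : 0 < p < 1 -> 0 < b ->
  (forall a, 0 < a -> is_beta_quantile p b a (q a)) ->
  filterlim q (at_right 0) (locally 0).
Proof.
intros Hp Hb Hq P [eps HP].
set (x := Rmin (eps / 2) (/ 2)).
assert (Hx : 0 < x <= / 2 /\ x < eps).
{ pose proof (cond_pos eps).
  assert (x <= eps / 2) by apply Rmin_l; assert (x <= / 2) by apply Rmin_r.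
  assert (0 < x) by (apply Rmin_glb_lt; lra); lra. }
destruct Hx as [Hx Hxe].
(* T bounds the tail for all a < 1, as t^(a-1) <= 1/x on (x,1). *)
set (T := beta_tail 1 b x / x).
assert (HT : 0 < T) by (apply Rdiv_lt_0_compat; [apply beta_tail_pos|]; lra).
destruct (beta_kernel_RInt_0_unbounded b x (2 * (p * T / (1 - p) + 1))) as [u [Hu HC]];
  [lra|].
assert (Hlnu : ln u < 0) by (rewrite <- ln_1; apply ln_increasing; lra).
assert (Hln2 : ln (/ 2) < 0) by (rewrite <- ln_1; apply ln_increasing; lra).
assert (He : 0 < Rmin 1 (ln (/ 2) / ln u)).
{ apply Rmin_glb_lt; [lra|].
  replace (ln (/ 2) / ln u) with (- ln (/ 2) / - ln u) by (field; lra).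
  apply Rdiv_lt_0_compat; lra. }
exists (mkposreal _ He); intros a Hball Ha; apply HP.
apply Rabs_def2 in Hball; unfold minus, plus, opp in Hball; simpl in Hball.
pose proof (Rmin_l 1 (ln (/ 2) / ln u)); pose proof (Rmin_r 1 (ln (/ 2) / ln u)).
assert (Ha1 : a < 1) by lra.
(* With u fixed, u^a tends to 1 as a tends to 0, so half of the integral at a = 0
   is retained. *)
assert (Hua : / 2 <= Rpower u a).
{ rewrite <- (exp_ln (/ 2)) by lra; apply exp_le_compat.
  assert (a <= ln (/ 2) / ln u) by lra.
  replace (ln (/ 2)) with (ln (/ 2) / ln u * ln u) by (field; lra).
  nra. }
assert (Hhead : p * T / (1 - p) + 1 <= beta_head a b x).
{ apply Rle_trans with (RInt (beta_kernel a b) u x);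
    [|apply RInt_le_beta_head; lra].
  replace a with (0 + a) by ring.
  apply Rle_trans with (Rpower u a * RInt (beta_kernel 0 b) u x);
    [|apply beta_kernel_RInt_shift; lra].
  assert (0 < p * T / (1 - p))
    by (apply Rdiv_lt_0_compat; [apply Rmult_lt_0_compat|]; lra).
  nra. }
assert (Htail : beta_tail a b x <= T).
{ pose proof (beta_tail_shift a b (1 - a) x) as Hs.
  replace (a + (1 - a)) with 1 in Hs by ring.
  pose proof (beta_tail_pos a b x).
  assert (x <= Rpower x (1 - a)).
  { rewrite <- (Rpower_1 x) at 1 by lra; apply exp_le_compat.
    assert (ln x < 0) by (rewrite <- ln_1; apply ln_increasing; lra); nra. }
  unfold T; apply Rmult_le_reg_r with x; [lra|].
  replace (beta_tail 1 b x / x * x) with (beta_tail 1 b x) by (field; lra).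
  nra. }
assert (Hqx : q a < x).
{ apply (beta_quantile_lt p b a); auto; try lra.
  rewrite quantile_gap_eq by lra.
  assert (p * T + (1 - p) <= (1 - p) * beta_head a b x).
  { replace (p * T + (1 - p)) with ((1 - p) * (p * T / (1 - p) + 1)) by (field; lra).
    apply Rmult_le_compat_l; lra. }
  assert (p * beta_tail a b x <= p * T) by (apply Rmult_le_compat_l; lra).
  lra. }
destruct (Hq a Ha) as [Hq01 _].
change (Rabs (q a - 0) < eps); apply Rabs_def1; lra.
Qed.

Lemma beta_quantile_lim_p_infty p b (q : R -> R) : 0 < p < 1 -> 0 < b ->
  (forall a, 0 < a -> is_beta_quantile p b a (q a)) ->
  filterlim q (Rbar_locally p_infty) (locally 1).
Proof.
intros Hp Hb Hq P [eps HP].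
set (x := Rmax (1 - eps / 2) (/ 2)).
assert (Hx : / 2 <= x < 1 /\ 1 - eps < x).
{ pose proof (cond_pos eps).
  assert (1 - eps / 2 <= x) by apply Rmax_l; assert (/ 2 <= x) by apply Rmax_r.
  assert (x < 1) by (apply Rmax_lub_lt; lra); lra. }
destruct Hx as [Hx Hxe].
set (y := (x + 1) / 2).
set (H0 := beta_head 1 b x); set (T0 := beta_tail 1 b y).
assert (HH0 : 0 < H0) by (apply beta_head_pos; lra).
assert (HT0 : 0 < T0) by (apply beta_tail_pos; unfold y; lra).
assert (Hxy : ln x < ln y) by (apply ln_increasing; unfold y; lra).
(* The gap at x is negative as soon as (x/y)^d < k, and x < y. *)
set (k := p * T0 / ((1 - p) * H0)).
assert (Hk : 0 < k)
  by (apply Rdiv_lt_0_compat; apply Rmult_lt_0_compat; lra).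
exists (1 + Rmax 0 (- ln k / (ln y - ln x))); intros a Ha; apply HP.
pose proof (Rmax_l 0 (- ln k / (ln y - ln x))).
pose proof (Rmax_r 0 (- ln k / (ln y - ln x))).
set (d := a - 1); assert (Hd : 0 < d) by (unfold d; lra).
assert (Had : a = 1 + d) by (unfold d; ring).
assert (Hratio : Rpower x d < k * Rpower y d).
{ unfold Rpower; rewrite <- (exp_ln k) at 1 by exact Hk; rewrite <- exp_plus.
  apply exp_increasing.
  assert (Hdk : - ln k < d * (ln y - ln x)); [|nra].
  replace (- ln k) with (- ln k / (ln y - ln x) * (ln y - ln x)) by (field; lra).
  apply Rmult_lt_compat_r; unfold d; lra. }
assert (Hqx : x < q a).
{ apply (lt_beta_quantile p b a); auto; try lra; [apply Hq; lra|].
  rewrite quantile_gap_eq, Had by lra.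
  pose proof (beta_head_shift 1 b d x) as Hh.
  pose proof (beta_tail_shift 1 b d y) as Ht.
  pose proof (beta_tail_Chasles (1 + d) b x y) as Hc.
  pose proof (beta_kernel_RInt_pos (1 + d) b x y).
  fold H0 in Hh; fold T0 in Ht.
  assert (Hh' : (1 - p) * beta_head (1 + d) b x <= Rpower x d * ((1 - p) * H0))
    by (specialize (Hh ltac:(lra) ltac:(lra) ltac:(lra) ltac:(lra)); nra).
  assert (Ht' : Rpower y d * (p * T0) < p * beta_tail (1 + d) b x).
  { assert (Rpower y d * T0 < beta_tail (1 + d) b x) by (unfold y in *; lra); nra. }
  assert (Hkk : k * Rpower y d * ((1 - p) * H0) = Rpower y d * (p * T0))
    by (unfold k; field; lra).
  assert (Rpower x d * ((1 - p) * H0) < k * Rpower y d * ((1 - p) * H0)).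
  { apply Rmult_lt_compat_r; [apply Rmult_lt_0_compat; lra | exact Hratio]. }
  lra. }
destruct (Hq a) as [Hq01 _]; [lra|].
change (Rabs (q a - 1) < eps); apply Rabs_def1; lra.
Qed.

(** * Analyticity *)

(** The kernel at [a + h] is [exp (ln t * h)] times the kernel at [a]; as [ln t] is
negative, the norm of the exponential is attained at [h = - r]. *)
Lemma wiener_ball_beta_kernel a b r t : 0 < r -> 0 < t < 1 ->
  wiener_ball r (beta_kernel (a - r) b t) (fun h => beta_kernel (a + h) b t).
Proof.
intros Hr Ht.
assert (Hln : ln t < 0) by (rewrite <- ln_1; apply ln_increasing; lra).
apply wiener_ball_ext with
  (fun h => beta_kernel a b t * ((exp (ln t * h) - 1) + 1)).
{ intros h _; rewrite beta_kernel_shift; unfold Rpower at 1.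
  rewrite (Rmult_comm h); ring. }
apply wiener_ball_weaken with
  (Rabs (beta_kernel a b t) * ((exp (Rabs (ln t) * r) - 1) + Rabs 1)).
{ right; unfold Rminus at 2; rewrite beta_kernel_shift, Rabs_R1.
  rewrite Rabs_pos_eq by apply Rlt_le, beta_kernel_pos.
  rewrite Rabs_left by exact Hln; unfold Rpower at 1.
  replace (- r * ln t) with (- ln t * r) by ring; ring. }
apply (wiener_ball_scal r _ _ (fun h => exp (ln t * h) - 1 + 1)).
apply (wiener_ball_plus r _ _ (fun h => exp (ln t * h) - 1)); [|apply wiener_ball_const|lra].
apply (wiener_ball_exp r _ (fun h => ln t * h)); [exact Hr|].
apply wiener_ball_scal, wiener_ball_id; lra.
Qed.

(** The radius needed for analyticity of an integral in [h] is the same integral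
at [a - r], which is finite as long as [r < a]. *)
Lemma wiener_ball_beta_RInt_gen a b r M (Fa Fb : (R -> Prop) -> Prop)
    (u v : nat -> R) (f : R -> R) :
  0 < r ->
  filterlim u eventually Fa -> filterlim v eventually Fb ->
  (forall n, 0 < u n < v n /\ v n < 1) ->
  (forall n, RInt (beta_kernel (a - r) b) (u n) (v n) <= M) ->
  (forall h, Rabs h < r -> is_RInt_gen (beta_kernel (a + h) b) Fa Fb (f h)) ->
  wiener_ball r M f.
Proof.
intros Hr Hu Hv Huv HM Hf.
apply wiener_ball_RInt_gen with
  (fun t h => beta_kernel (a + h) b t) (beta_kernel (a - r) b) Fa Fb u v; auto.
- intros n; apply Huv.
- intros n t Ht; specialize (Huv n); apply wiener_ball_beta_kernel; lra.
- intros n; specialize (Huv n); apply beta_kernel_ex_RInt; lra.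
- intros n h _; specialize (Huv n).
  apply (beta_kernel_ex_RInt (a + h) b); lra.
Qed.

Lemma filterlim_at_right (u : nat -> R) (l : R) :
  is_lim_seq u l -> (forall n, l < u n) -> filterlim u eventually (at_right l).
Proof.
intros Hu Hpos P HP; destruct (Hu _ HP) as [N HN].
exists N; intros n Hn; apply HN; auto.
Qed.

Lemma filterlim_at_left (u : nat -> R) (l : R) :
  is_lim_seq u l -> (forall n, u n < l) -> filterlim u eventually (at_left l).
Proof.
intros Hu Hpos P HP; destruct (Hu _ HP) as [N HN].
exists N; intros n Hn; apply HN; auto.
Qed.

Lemma is_lim_seq_half_pow c : is_lim_seq (fun n => c * (/ 2) ^ S n) 0.
Proof.
replace 0 with (c * 0) by ring; apply (is_lim_seq_scal_l _ c 0).
apply (is_lim_seq_incr_1 (fun n => (/ 2) ^ n)), is_lim_seq_geom.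
rewrite Rabs_pos_eq; lra.
Qed.

Lemma half_pow_bounds n : 0 < (/ 2) ^ S n < 1.
Proof.
split; [apply pow_lt; lra|].
apply pow_lt_1_compat; [lra | lia].
Qed.

Lemma wiener_ball_beta_head a b r x : 0 < r < a -> 0 < b -> 0 < x < 1 ->
  exists M, wiener_ball r M (fun h => beta_head (a + h) b x).
Proof.
intros Hr Hb Hx; exists (beta_head (a - r) b x).
apply (wiener_ball_beta_RInt_gen a b r _ (at_right 0) (at_point x)
  (fun n => x * (/ 2) ^ S n) (fun _ => x)); try lra.
- apply filterlim_at_right; [apply is_lim_seq_half_pow|].
  intros n; apply Rmult_lt_0_compat; [lra | apply half_pow_bounds].
- intros P HP; exists 0%nat; intros n _; exact HP.
- intros n; pose proof (half_pow_bounds n); nra.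
- intros n; pose proof (half_pow_bounds n); apply RInt_le_beta_head; nra.
- intros h Hh; apply Rabs_def2 in Hh; apply beta_head_spec; lra.
Qed.

Lemma wiener_ball_beta_tail a b r x : 0 < r < a -> 0 < b -> 0 < x < 1 ->
  exists M, wiener_ball r M (fun h => beta_tail (a + h) b x).
Proof.
intros Hr Hb Hx; exists (beta_tail (a - r) b x).
apply (wiener_ball_beta_RInt_gen a b r _ (at_point x) (at_left 1)
  (fun _ => x) (fun n => 1 - (1 - x) * (/ 2) ^ S n)); try lra.
- intros P HP; exists 0%nat; intros n _; exact HP.
- apply filterlim_at_left.
  + replace (Finite 1) with (Finite (1 - 0)) by (f_equal; ring).
    apply is_lim_seq_minus'; [apply is_lim_seq_const | apply is_lim_seq_half_pow].
  + intros n; pose proof (half_pow_bounds n); nra.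
- intros n; pose proof (half_pow_bounds n); nra.
- intros n; pose proof (half_pow_bounds n); apply RInt_le_beta_tail; nra.
- intros h Hh; apply Rabs_def2 in Hh; apply beta_tail_spec; lra.
Qed.

Lemma wiener_ball_quantile_gap p a b r x : 0 < r < a -> 0 < b -> 0 < x < 1 ->
  exists M, wiener_ball r M (fun h => quantile_gap p b (a + h) x).
Proof.
intros Hr Hb Hx.
destruct (wiener_ball_beta_head a b r x) as [M1 H1]; auto.
destruct (wiener_ball_beta_head a b r (/ 2)) as [M2 H2]; auto; [lra|].
destruct (wiener_ball_beta_tail a b r (/ 2)) as [M3 H3]; auto; [lra|].
exists (M1 + Rabs (- p) * (M2 + M3)).
apply wiener_ball_ext with (fun h => beta_head (a + h) b x +
  - p * (beta_head (a + h) b (/ 2) + beta_tail (a + h) b (/ 2))).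
{ intros h _; unfold quantile_gap; ring. }
apply wiener_ball_plus; [exact H1 | | lra].
apply (wiener_ball_scal r _ (- p)
  (fun h => beta_head (a + h) b (/ 2) + beta_tail (a + h) b (/ 2))).
apply wiener_ball_plus; auto; lra.
Qed.

Lemma beta_kernel_ratio a b x h y : 0 < x < 1 -> 0 < x + y < 1 ->
  beta_kernel (a + h) b (x + y) / beta_kernel a b x =
  exp ((a - 1 + h) * ln (1 + / x * y) + (ln x * h +
       (b - 1) * ln (1 + - / (1 - x) * y))).
Proof.
intros Hx Hy.
replace (1 + / x * y) with ((x + y) * / x) by (field; lra).
replace (1 + - / (1 - x) * y) with ((1 - (x + y)) * / (1 - x)) by (field; lra).
rewrite !ln_mult, !ln_Rinv by (try apply Rinv_0_lt_compat; lra).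
unfold Rdiv, beta_kernel, Rpower.
rewrite <- !exp_plus, <- exp_Ropp, <- exp_plus.
f_equal; ring.
Qed.

(** The exponent in [beta_kernel_ratio] is built from [h], [ln (1 + y / x)] and
[ln (1 - y / (1 - x))], whose norms are small for small [r] and [s]; hence so is
the norm of its exponential minus 1. *)
Lemma beta_kernel_ratio_near_1 a b x : 0 < x < 1 ->
  exists s r0, 0 < s /\ s <= x / 2 /\ s <= (1 - x) / 2 /\ 0 < r0 /\
    forall r y, 0 < r <= r0 -> wiener_ball r s y ->
      wiener_ball r (/ 2)
        (fun h => beta_kernel (a + h) b (x + y h) / beta_kernel a b x - 1).
Proof.
intros Hx.
(* With |h| < 1, the exponent has norm at most C s + |ln x| r; each term is made at
   most 1/6, since exp (1/3) - 1 <= 1/2.  The factors 2 come from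
   A / (1 - A) <= 2 A for A <= 1/2. *)
set (C := (Rabs (a - 1) + 1) * (2 / x) + Rabs (b - 1) * (2 / (1 - x)) + 1).
assert (Hx2 : 0 < 2 / x) by (apply Rdiv_lt_0_compat; lra).
assert (Hy2 : 0 < 2 / (1 - x)) by (apply Rdiv_lt_0_compat; lra).
pose proof (Rabs_pos (a - 1)) as Hpa; pose proof (Rabs_pos (b - 1)) as Hpb.
pose proof (Rabs_pos (ln x)) as Hpl.
assert (HC : 0 < C).
{ unfold C; pose proof (Rmult_le_pos _ _ Hpb (Rlt_le _ _ Hy2)); nra. }
set (s := Rmin (Rmin (x / 2) ((1 - x) / 2)) (/ (6 * C))).
set (r0 := Rmin 1 (/ (6 * (Rabs (ln x) + 1)))).
assert (Hs0 : 0 < s).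
{ repeat apply Rmin_glb_lt; try lra; apply Rinv_0_lt_compat; lra. }
assert (Hr0 : 0 < r0).
{ apply Rmin_glb_lt; [lra|]; apply Rinv_0_lt_compat; lra. }
assert (Hsx : s <= x / 2) by (eapply Rle_trans; apply Rmin_l).
assert (Hsy : s <= (1 - x) / 2)
  by (eapply Rle_trans; [apply Rmin_l | apply Rmin_r]).
assert (HsC : C * s <= / 6).
{ apply Rle_trans with (C * / (6 * C)).
  - apply Rmult_le_compat_l; [lra | apply Rmin_r].
  - right; field; lra. }
assert (Hr1 : r0 <= 1) by apply Rmin_l.
assert (Hrl : Rabs (ln x) * r0 <= / 6).
{ apply Rle_trans with ((Rabs (ln x) + 1) * / (6 * (Rabs (ln x) + 1))).
  - apply Rmult_le_compat; try lra; apply Rmin_r.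
  - right; field; lra. }
exists s, r0; repeat split; auto; intros r y Hr Hy.
assert (Hlog : forall c, Rabs c * s <= / 2 ->
  wiener_ball r (2 * Rabs c * s) (fun h => ln (1 + c * y h))).
{ intros c Hc.
  apply wiener_ball_weaken with ((Rabs c * s) / (1 - Rabs c * s)).
  - pose proof (Rmult_le_pos _ _ (Rabs_pos c) (Rlt_le _ _ Hs0)) as H0.
    apply Rmult_le_reg_r with (1 - Rabs c * s); [lra|].
    unfold Rdiv; rewrite Rmult_assoc, Rinv_l by lra; nra.
  - apply (wiener_ball_ln_1p r _ (fun h => c * y h)); [lra | lra |].
    apply wiener_ball_scal, Hy. }
set (M := (Rabs (a - 1) + r) * (2 * Rabs (/ x) * s) + (Rabs (ln x) * r +
          Rabs (b - 1) * (2 * Rabs (- / (1 - x)) * s))).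
assert (Hix : Rabs (/ x) = / x)
  by (apply Rabs_pos_eq, Rlt_le, Rinv_0_lt_compat; lra).
assert (Hiy : Rabs (- / (1 - x)) = / (1 - x))
  by (rewrite Rabs_Ropp; apply Rabs_pos_eq, Rlt_le, Rinv_0_lt_compat; lra).
assert (HM : M <= / 3).
{ unfold M; rewrite Hix, Hiy.
  apply Rle_trans with (C * s + Rabs (ln x) * r0); [|lra].
  unfold C, Rdiv in *.
  assert (H1 : 0 <= 2 * / x * s) by (pose proof (Rmult_lt_0_compat _ _ Hx2 Hs0); lra).
  assert (H2 : r * (2 * / x * s) <= 1 * (2 * / x * s))
    by (apply Rmult_le_compat_r; lra).
  assert (H3 : Rabs (ln x) * r <= Rabs (ln x) * r0)
    by (apply Rmult_le_compat_l; lra).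
  lra. }
apply wiener_ball_weaken with (exp M - 1).
{ assert (HM3 : exp M <= exp (/ 3)) by (apply exp_le_compat, HM).
  pose proof (exp_ineq1_le (- / 3)) as He.
  rewrite exp_Ropp in He; pose proof (exp_pos (/ 3)) as Hp.
  assert (exp (/ 3) <= 3 / 2); [|lra].
  apply Rmult_le_reg_l with (/ exp (/ 3)); [apply Rinv_0_lt_compat, Hp|].
  rewrite Rinv_l by lra; lra. }
apply wiener_ball_ext with (fun h => exp
  ((a - 1 + h) * ln (1 + / x * y h) + (ln x * h +
    (b - 1) * ln (1 + - / (1 - x) * y h))) - 1).
{ intros h Hh; rewrite beta_kernel_ratio; [reflexivity | exact Hx|].
  pose proof (wiener_ball_abs_le _ _ _ h Hy Hh) as Hyh.
  apply Rabs_le_between in Hyh; lra. }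
apply (wiener_ball_exp r M (fun h => (a - 1 + h) * ln (1 + / x * y h) + (ln x * h +
    (b - 1) * ln (1 + - / (1 - x) * y h)))); [lra|].
unfold M; apply wiener_ball_plus; [| |lra].
- apply (wiener_ball_mult r _ _ (fun h => a - 1 + h)); [lra| |].
  + apply wiener_ball_plus; [apply wiener_ball_const | apply wiener_ball_id |]; lra.
  + apply Hlog; rewrite Hix; apply Rmult_le_reg_l with x; [lra|].
    rewrite <- Rmult_assoc, Rinv_r; lra.
- apply wiener_ball_plus; [| |lra].
  + apply (wiener_ball_scal r _ _ (fun h => h)), wiener_ball_id; lra.
  + apply (wiener_ball_scal r _ _ (fun h => ln (1 + - / (1 - x) * y h))).
    apply Hlog; rewrite Hiy; apply Rmult_le_reg_l with (1 - x); [lra|].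
    rewrite <- Rmult_assoc, Rinv_r; lra.
Qed.

Lemma beta_kernel_ratio_continuous a b x y k th :
  0 < x < 1 -> 0 < x + y < 1 -> 0 <= th <= 1 ->
  continuous (fun th => beta_kernel a b (x + th * y) / k - 1) th.
Proof.
intros Hx Hy Hth; apply (ex_derive_continuous (V := R_NormedModule)).
assert (Hmid : 0 < x + th * y < 1).
{ destruct (Rle_lt_dec 0 y); split; nra. }
unfold beta_kernel, Rpower; auto_derive; lra.
Qed.

(** The mean value form of an increment of the gap, with the average of the kernel
written as [k] times a perturbation of 1.  The integration range (0,1) does not
depend on [x] and [y], so that both may be functions of [h]. *)
Lemma beta_kernel_RInt_ratio a b x y k : 0 < x < 1 -> 0 < x + y < 1 -> k <> 0 ->
  RInt (beta_kernel a b) x (x + y) =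
  k * (y * (1 + RInt (fun th => beta_kernel a b (x + th * y) / k - 1) 0 1)).
Proof.
intros Hx Hy Hk.
assert (Hex : ex_RInt (fun th => beta_kernel a b (x + th * y) / k - 1) 0 1).
{ apply continuous_ex_RInt; rewrite Rmin_left, Rmax_right by lra.
  intros th Hth; apply beta_kernel_ratio_continuous; auto. }
assert (Hlin : RInt (fun th => y * beta_kernel a b (y * th + x)) 0 1 =
  RInt (beta_kernel a b) x (x + y)).
{ pose proof (RInt_comp_lin (V := R_CompleteNormedModule)
    (beta_kernel a b) y x 0 1) as Hc.
  replace (y * 0 + x) with x in Hc by ring.
  replace (y * 1 + x) with (x + y) in Hc by ring.
  apply Hc, beta_kernel_ex_RInt; lra. }
rewrite <- Hlin.
assert (H1 : RInt (fun _ => 1) 0 1 = 1)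
  by (rewrite RInt_const; unfold scal; simpl; unfold mult; simpl; ring).
rewrite <- H1 at 2.
assert (Hplus : RInt (fun _ => 1) 0 1 +
    RInt (fun th => beta_kernel a b (x + th * y) / k - 1) 0 1 =
  RInt (fun th => 1 + (beta_kernel a b (x + th * y) / k - 1)) 0 1).
{ symmetry; apply (RInt_plus (V := R_CompleteNormedModule)); auto.
  apply (ex_RInt_const (V := R_NormedModule)). }
rewrite Hplus, <- Rmult_assoc.
assert (Hscal : (k * y) * RInt (fun th => 1 + (beta_kernel a b (x + th * y) / k - 1)) 0 1 =
  RInt (fun th => (k * y) * (1 + (beta_kernel a b (x + th * y) / k - 1))) 0 1).
{ symmetry; apply (RInt_scal (V := R_CompleteNormedModule)
    (fun th => 1 + (beta_kernel a b (x + th * y) / k - 1))).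
  apply (ex_RInt_plus (V := R_NormedModule)); auto.
  apply (ex_RInt_const (V := R_NormedModule)). }
rewrite Hscal; apply RInt_ext; intros th _.
match goal with |- @eq _ ?l ?r => change (@eq R l r) end.
replace (y * th + x) with (x + th * y) by ring; field; exact Hk.
Qed.

(** The simplified Newton iteration described above.  Membership in the ball of
radius [s] is all that has to be tracked for the iterates as functions of [h];
their convergence is a contraction estimate for each single [h]. *)
Lemma beta_quantile_wiener_ball p b a (q : R -> R) : 0 < p < 1 -> 0 < b -> 0 < a ->
  (forall a, 0 < a -> is_beta_quantile p b a (q a)) ->
  exists r M, 0 < r /\ wiener_ball r M (fun h => q (a + h)).
Proof.
intros Hp Hb Ha Hq; set (x := q a).
destruct (proj1 (is_beta_quantile_iff p b a x Ha Hb) (Hq a Ha)) as [Hx Hx0].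
set (k := beta_kernel a b x); assert (Hk : 0 < k) by apply beta_kernel_pos.
destruct (beta_kernel_ratio_near_1 a b x Hx) as [s [r0 [Hs [Hsx [Hsy [Hr0 Hratio]]]]]].
fold k in Hratio.
destruct (wiener_ball_quantile_gap p a b (a / 2) x) as [G HG]; try lra.
pose proof (wiener_ball_nonneg _ _ _ HG) as HG0.
(* The last bound makes the gap at x, which vanishes at h = 0, at most k s / 2. *)
set (r := Rmin (Rmin r0 (a / 2)) (k * s * a / (4 * (G + 1)))).
assert (Hr : 0 < r).
{ repeat apply Rmin_glb_lt; try lra; apply Rdiv_lt_0_compat; [|lra].
  apply Rmult_lt_0_compat; [apply Rmult_lt_0_compat|]; lra. }
assert (Hrr0 : r <= r0) by (eapply Rle_trans; apply Rmin_l).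
assert (Hra : r <= a / 2) by (eapply Rle_trans; [apply Rmin_l | apply Rmin_r]).
assert (Hgap : wiener_ball r (k * (s / 2)) (fun h => quantile_gap p b (a + h) x)).
{ apply wiener_ball_weaken with (G * r / (a / 2)).
  - apply Rle_trans with ((G + 1) * (k * s * a / (4 * (G + 1))) / (a / 2)).
    + apply Rmult_le_compat_r; [apply Rlt_le, Rinv_0_lt_compat; lra|].
      apply Rmult_le_compat; try lra; apply Rmin_r.
    + right; field; lra.
  - apply (wiener_ball_shrink (a / 2) r G (fun h => quantile_gap p b (a + h) x));
      try lra; [|exact HG].
    rewrite Rplus_0_r; exact Hx0. }
(* 1 + rho z w h is the average of K(a+h,.)/k over the segment from x+z to x+z+w. *)
set (rho := fun z w h =>
  RInt (fun th => beta_kernel (a + h) b (x + z + th * w) / k - 1) 0 1).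
assert (Hgap_rho : forall h z w, Rabs h < r -> - s <= z <= s -> - s <= z + w <= s ->
  quantile_gap p b (a + h) (x + (z + w)) =
  quantile_gap p b (a + h) (x + z) + k * (w * (1 + rho z w h))).
{ intros h z w Hh Hz Hzw; apply Rabs_def2 in Hh.
  rewrite (quantile_gap_Chasles p b (a + h) (x + z)) by lra.
  replace (x + (z + w)) with (x + z + w) by ring.
  rewrite (beta_kernel_RInt_ratio _ _ _ _ k); [reflexivity | lra..]. }
assert (Hrho : forall h z w, Rabs h < r -> - s <= z <= s -> - s <= z + w <= s ->
  Rabs (rho z w h) <= / 2).
{ intros h z w Hh Hz Hzw.
  replace (/ 2) with ((1 - 0) * / 2) by field.
  apply abs_RInt_le_const; [lra| |].
  - apply continuous_ex_RInt; rewrite Rmin_left, Rmax_right by lra; intros th Hth.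
    apply beta_kernel_ratio_continuous; lra.
  - intros th Hth.
    assert (Hc : wiener_ball r s (fun _ => z + th * w)).
    { apply wiener_ball_weaken with (Rabs (z + th * w)); [|apply wiener_ball_const].
      apply Rabs_le; split; nra. }
    replace (x + z + th * w) with (x + (z + th * w)) by ring.
    apply (wiener_ball_abs_le r _
      (fun h => beta_kernel (a + h) b (x + (z + th * w)) / k - 1)); [|exact Hh].
    apply (Hratio r (fun _ => z + th * w)); [lra | exact Hc]. }
(* The slope of the gap is at least k / 2 and its value at x is at most k s / 2 in
   absolute value, so it changes sign between x - s and x + s. *)
assert (Hroot : forall h, Rabs h < r -> - s <= q (a + h) - x <= s).
{ intros h Hh; pose proof (Rabs_def2 _ _ Hh) as Hh'.
  pose proof (wiener_ball_abs_le _ _ _ h Hgap Hh) as Hg.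
  apply Rabs_le_between in Hg.
  assert (Hah : 0 < a + h) by lra.
  destruct (proj1 (is_beta_quantile_iff p b _ _ Hah Hb) (Hq _ Hah)) as [Hq1 Hq0].
  pose proof (Hgap_rho h 0 s Hh ltac:(lra) ltac:(lra)) as H1.
  pose proof (Hgap_rho h 0 (- s) Hh ltac:(lra) ltac:(lra)) as H2.
  pose proof (Hrho h 0 s Hh ltac:(lra) ltac:(lra)) as R1.
  pose proof (Hrho h 0 (- s) Hh ltac:(lra) ltac:(lra)) as R2.
  apply Rabs_le_between in R1; apply Rabs_le_between in R2.
  rewrite Rplus_0_r in H1, H2; rewrite Rplus_0_l in H1, H2.
  assert (K1 : k * (s / 2) <= k * (s * (1 + rho 0 s h)))
    by (apply Rmult_le_compat_l; nra).
  assert (K2 : k * (- s * (1 + rho 0 (- s) h)) <= k * - (s / 2))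
    by (apply Rmult_le_compat_l; nra).
  split; apply Rnot_lt_le; intros Hlt.
  - assert (Hlt' : q (a + h) < x + - s) by lra.
    apply (quantile_gap_lt_iff p b (a + h)) in Hlt'; lra.
  - assert (Hlt' : x + s < q (a + h)) by lra.
    apply (quantile_gap_lt_iff p b (a + h)) in Hlt'; lra. }
set (newton := fun (y : R -> R) h => y h - quantile_gap p b (a + h) (x + y h) / k).
(* newton y = - gap(x)/k - y rho has norm at most s/2 + s/2. *)
assert (Hball : forall y, wiener_ball r s y -> wiener_ball r s (newton y)).
{ intros y Hy.
  assert (Hyb : forall h, Rabs h < r -> - s <= y h <= s).
  { intros h Hh; apply Rabs_le_between, (wiener_ball_abs_le r _ y); auto. }
  apply wiener_ball_ext with (fun h =>
    - / k * quantile_gap p b (a + h) x + -1 * (y h * rho 0 (y h) h)).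
  { intros h Hh; unfold newton; specialize (Hyb h Hh).
    rewrite <- (Rplus_0_l (y h)) at 4.
    rewrite Hgap_rho by (exact Hh || lra); rewrite Rplus_0_r; field; lra. }
  apply wiener_ball_weaken with
    (Rabs (- / k) * (k * (s / 2)) + Rabs (-1) * (s * RInt (fun _ => / 2) 0 1)).
  { rewrite Rabs_Ropp, Rabs_m1, Rabs_pos_eq by (apply Rlt_le, Rinv_0_lt_compat, Hk).
    rewrite RInt_const; unfold scal; simpl; unfold mult; simpl.
    right; field; lra. }
  apply wiener_ball_plus; [| |lra].
  - apply (wiener_ball_scal r _ _ (fun h => quantile_gap p b (a + h) x)), Hgap.
  - apply (wiener_ball_scal r _ _ (fun h => y h * rho 0 (y h) h)).
    apply wiener_ball_mult; auto.
    apply (wiener_ball_RInt r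
      (fun th h => beta_kernel (a + h) b (x + 0 + th * y h) / k - 1)); try lra.
    + intros th Hth; rewrite Rplus_0_r.
      apply (Hratio r (fun h => th * y h)); [lra|].
      apply wiener_ball_weaken with (Rabs th * s); [|apply wiener_ball_scal, Hy].
      rewrite Rabs_pos_eq by lra; nra.
    + apply (ex_RInt_const (V := R_NormedModule)).
    + intros h Hh; specialize (Hyb h Hh).
      apply continuous_ex_RInt; rewrite Rmin_left, Rmax_right by lra; intros th Hth.
      apply (beta_kernel_ratio_continuous (a + h) b (x + 0)); lra. }
set (yn := fun n => Nat.iter n newton (fun _ => 0)).
assert (Hyn : forall n, wiener_ball r s (yn n)).
{ induction n as [|n IH]; [|exact (Hball _ IH)].
  apply wiener_ball_weaken with (Rabs 0); [rewrite Rabs_R0; lra|].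
  apply wiener_ball_const. }
assert (Hconv : forall n h, Rabs h < r ->
  Rabs (yn n h - (q (a + h) - x)) <= s * (/ 2) ^ n).
{ intros n h Hh; specialize (Hroot h Hh).
  induction n as [|n IH].
  - unfold yn; simpl; apply Rabs_le; lra.
  - assert (Hb' : - s <= yn n h <= s)
      by (apply Rabs_le_between, (wiener_ball_abs_le r _ (yn n)); auto).
    pose proof (Rabs_def2 _ _ Hh) as Hh'.
    assert (Hah : 0 < a + h) by lra.
    destruct (proj1 (is_beta_quantile_iff p b _ _ Hah Hb) (Hq _ Hah)) as [Hq1 Hq0].
    set (z := q (a + h) - x) in *; set (w := yn n h - z) in *.
    assert (Hzw : z + w = yn n h) by (unfold w; ring).
    pose proof (Hgap_rho h z w Hh ltac:(lra) ltac:(lra)) as H1.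
    pose proof (Hrho h z w Hh ltac:(lra) ltac:(lra)) as R1.
    replace (x + z) with (q (a + h)) in H1 by (unfold z; ring).
    rewrite Hq0, Hzw in H1.
    change (yn (S n) h) with (newton (yn n) h); unfold newton; rewrite H1.
    replace (yn n h - (0 + k * (w * (1 + rho z w h))) / k - z) with
      (- (w * rho z w h)) by (rewrite <- Hzw; field; lra).
    rewrite Rabs_Ropp, Rabs_mult; simpl.
    replace (s * (/ 2 * (/ 2) ^ n)) with (s * (/ 2) ^ n * / 2) by ring.
    apply Rmult_le_compat; auto using Rabs_pos. }
exists r, (s + Rabs x); split; [exact Hr|].
apply wiener_ball_ext with (fun h => (q (a + h) - x) + x); [intros; ring|].
apply (wiener_ball_plus r _ _ (fun h => q (a + h) - x)); [|apply wiener_ball_const|lra].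
apply wiener_ball_lim with (fun _ => s) yn; auto; [apply is_lim_seq_const|].
intros h Hh.
apply is_lim_seq_ext with (fun n => (yn n h - (q (a + h) - x)) + (q (a + h) - x));
  [intros; ring|].
replace (Finite (q (a + h) - x)) with (Finite (0 + (q (a + h) - x)))
  by (f_equal; ring).
apply is_lim_seq_plus'; [|apply is_lim_seq_const].
apply is_lim_seq_abs_0.
apply is_lim_seq_le_le with (fun _ => 0) (fun n => s * (/ 2) ^ n).
- intros n; split; [apply Rabs_pos | apply Hconv, Hh].
- apply is_lim_seq_const.
- apply (is_lim_seq_incr_1 (fun n => s * (/ 2) ^ n)), is_lim_seq_half_pow.
Qed.

Theorem proposition1p2 (p b : R) (hp : 0 < p < 1) (hb : 0 < b) :
  (forall a : R, 0 < a -> exists! x : R, is_beta_quantile p b a x) /\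
  (forall q : R -> R,
     (forall a : R, 0 < a -> is_beta_quantile p b a (q a)) ->
     real_analytic_on (fun a => 0 < a) q /\
     increasing_on (fun a => 0 < a) q /\
     filterlim q (at_right 0) (locally 0) /\
     filterlim q (Rbar_locally p_infty) (locally 1)).
Proof.
split.
- intros a Ha; now apply beta_quantile_exists_unique.
- intros q Hq; split; [|split; [|split]].
  + intros a Ha.
    destruct (beta_quantile_wiener_ball p b a q hp hb Ha Hq) as [r [M [Hr [c [_ Hc]]]]].
    exists c, (mkposreal r Hr); intros x Hxa.
    replace (q x) with (q (a + (x - a))) by (f_equal; ring).
    apply Hc, Hxa.
  + intros x y Hx Hy Hxy.
    apply (beta_quantile_increasing p b x (y - x)); auto; try lra.
    replace (x + (y - x)) with y by ring; auto.
  + now apply beta_quantile_lim_0 with p b.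
  + now apply beta_quantile_lim_p_infty with p b.
Qed.
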